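(* Let $p$ be a prime and $n$ a positive integer. Suppose that $G$ is a finite solvable group acted on by automorphisms by an elementary abelian $p$-group $A$ with $|A|\geq p^{n+1}$. If this action is good and $C_G(a)$ has Fitting height at most $n$ for every nontrivial element $a\in A$, then $G$ has Fitting height at most $n+1$. Moreover, if $|A|\geq p^{n+2}$, then $G$ has Fitting height at most $n$.
   Context: All groups are finite. If a group $A$ acts on a group $G$ by automorphisms, the action is called good if $H=[H,B]C_H(B)$ for every subgroup $B\le A$ and every $B$-invariant subgroup $H\le G$. The Fitting height of a solvable group is the length of its shortest normal series with nilpotent factors. *)

(* Defs.v *)
From mathcomp Require Import all_boot all_fingroup all_solvable.
Set Implicit Arguments. Unset Strict Implicit. Unset Printing Implicit Defensive.
Local Open Scope group_scope.

Definition act_commg (aT rT : finGroupType) (D : {set aT}) (R : {set rT})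
  (to : groupAction D R) (H : {set rT}) (B : {set aT}) : {set rT} :=
  <<[set x^-1 * to x b | x in H, b in B]>>.

Definition good_action (aT rT : finGroupType) (A : {group aT}) (G : {group rT})
  (to : groupAction A G) : Prop :=
  forall (B : {group aT}) (H : {group rT}),
    B \subset A -> H \subset G -> [acts B, on H | to] ->
    (H : {set rT}) = act_commg to H B * 'C_(H | to)(B).

Definition fitting_height_le (gT : finGroupType) (G : {set gT}) (n : nat) : Prop :=
  exists f : nat -> {group gT},
    [/\ f 0%N :=: 1, f n :=: G &
      forall i, (i < n)%N ->
        [/\ f i <| G, f i \subset f i.+1 & nilpotent (f i.+1 / f i)]].

(* Main.v *)
(* Goodness of the action makes [G, A] a p'-group, so that A acts on the A-invariant
   sections of G as in the coprime case. If G does not have Fitting height at most h,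
   it contains a tower P 0, ..., P h of A-invariant groups of prime power order,
   consecutive primes being distinct, each acting nontrivially on the next. In a
   minimal tower every level is irreducible modulo a small kernel, so that passing
   from P k to P k.+1 costs the centraliser in A at most one factor p. If this
   centraliser survives to the top, some a != 1 in A centralises the whole tower,
   which then lies in C_G(a). In the borderline case |A| = p^(n+1), h = n + 1, the
   fixed points of the elements b of A that move P 0 generate the levels below the
   top level V, while C_V(b) must centralise those of the level W below V. It follows
   that P 0 centralises Z(W) (by conjugacy of Sylow subgroups), and then that
   C_V(b) = 1. But twisting the fixed points of b by abelian subgroups moved by b
   produces such subgroups at every level of the tower, whence C_V(b) != 1. *)
Require Import Defs.
From mathcomp Require Import all_boot all_fingroup all_solvable.
From mathcomp Require Import ssralg finalg.
Set Implicit Arguments. Unset Strict Implicit. Unset Printing Implicit Defensive.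
Import GroupScope.
Local Open Scope group_scope.

(** * Commutators and centralisers modulo a normalised subgroup *)

Section ThreeSubgroups.
Variable gT : finGroupType.
Implicit Types (G H K N P Q S T U : {group gT}) (b : gT).

(** The engine is one fact: let [N] and [U] be abelian and [b]-invariant, [N] acting on [U] with
    order prime to [p] and to [#|U|]; if [b] has no fixed points in [U], then [N, b] centralises
    [U]. It needs [N] abelian, while levels of a minimal tower only have class at most 2 modulo
    their kernels. So abelian subgroups moved by [b] have to be manufactured: for [y] fixed by [b],
    the conjugates [y ^ n] need not commute, but suitable products of [y ^ n] with a power of
    [y ^ n^-1] do. The sign of that power is chosen so that [b] cannot fix them all: with a plus
    sign the only escape is that [b] inverts, impossible for odd [p]; for [p = 2] a minus sign is
    used. The constants come from a count. Each level, the first included, costs at most one factor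
    p, so order p^(n+2) leaves a nontrivial element centralising n+1 levels. With order p^(n+1),
    either this still happens, or every level costs exactly p. That rigidity supplies, at each level
    below the top but the first, an element [a] trivial on all lower levels whose fixed points there
    lie in a small kernel; paired with [b], it makes fixed points generate. *)

Lemma three_subgroup_mod T G H K :
    G \subset 'N(T) -> H \subset 'N(T) -> K \subset 'N(T) ->
  [~: G, H, K] \subset T -> [~: H, K, G] \subset T -> [~: K, G, H] \subset T.
Proof.
have RmodT (A B C : {group gT}) : A \subset 'N(T) -> B \subset 'N(T) -> C \subset 'N(T) ->
    ([~: A, B, C] \subset T) = ([~: A / T, B / T, C / T] == 1).
  move=> nA nB nC; have nR : [~: A, B] \subset 'N(T) by rewrite comm_subG.
  by rewrite -!quotientR // -subG1 quotient_sub1 // comm_subG.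
move=> nG nH nK; rewrite !RmodT // => /eqP h1 /eqP h2.
by apply/eqP; apply: (@three_subgroup _ (G / T)%G (H / T)%G (K / T)%G).
Qed.

(** The preimage under [coset T] asks for no inclusion between [T] and [P]: in towers [T] lies in
    [Q], in the passage to quotients it lies in [P]. *)
Definition modcent P Q T : {set gT} := P :&: coset T @*^-1 'C(Q / T).

Canonical modcent_group P Q T := Eval hnf in [group of modcent P Q T].

Lemma modcent_sub P Q T : modcent P Q T \subset P.
Proof. exact: subsetIl. Qed.

Lemma sub_modcent P Q T (A : {set gT}) :
    P \subset 'N(T) -> Q \subset 'N(T) -> A \subset P ->
  (A \subset modcent P Q T) = ([~: A, Q] \subset T).
Proof.
move=> nP nQ sAP; have nA := subset_trans sAP nP.
by rewrite subsetI sAP -sub_quotient_pre // quotient_cents2.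
Qed.

Lemma modcent_comm P Q T :
  P \subset 'N(T) -> Q \subset 'N(T) -> [~: modcent P Q T, Q] \subset T.
Proof. by move=> nP nQ; rewrite -(sub_modcent nP) ?modcent_sub. Qed.

Lemma modcent_norm P Q T (A : {group gT}) :
    P \subset 'N(T) -> Q \subset 'N(T) ->
    A \subset 'N(P) -> A \subset 'N(Q) -> A \subset 'N(T) ->
  A \subset 'N(modcent P Q T).
Proof.
move=> nTP nTQ nP nQ nT; apply/normsP=> x Ax; apply/eqP.
rewrite eqEcard cardJg leqnn andbT.
have sMP : modcent P Q T :^ x \subset P.
  by rewrite -(normsP nP x Ax) conjSg modcent_sub.
rewrite sub_modcent //.
have -> : [~: modcent P Q T :^ x, Q] = [~: modcent P Q T, Q] :^ x.
  by rewrite conjsRg (normsP nQ).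
by rewrite sub_conjg (normsP nT) ?groupV // modcent_comm.
Qed.

End ThreeSubgroups.

(** * Norm maps, coprime action and generation by fixed points *)

Import GRing.Theory FinRing.Theory.
Import FiniteModule.

(* Summing over the conjugates x^-1 <b> x, x in N0 = [N, b], of the norm map
   u |-> \prod_i u ^ (b ^+ i) shows that #|N0| U lies in S 'C_U(N0). *)
Lemma comm_sub_of_cent_sub (gT : finGroupType) (U N S : {group gT}) b p :
    abelian U -> abelian N -> N \subset 'N(U) -> b \in 'N(U) -> b \in 'N(N) ->
    prime p -> b ^+ p = 1 -> coprime #|N| p -> coprime #|U| #|N| ->
    S \subset U -> N \subset 'N(S) -> b \in 'N(S) -> 'C_U[b] \subset S ->
  [~: U, [~: N, <[b]>]] \subset S.
Proof.
move=> abU abN nUN nUb nNb pr_p bp1 coNp coUN sSU nSN nSb sCS.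
have nNB : <[b]> \subset 'N(N) by rewrite cycle_subG.
set N0 := [~: N, <[b]>]%G.
have sN0N : N0 \subset N by rewrite commg_subl.
have ob : #[b] %| p by rewrite order_dvdn bp1.
have coNb : coprime #|N| #|<[b]>| by apply: coprime_dvdr coNp.
have tiN0 : 'C_N0(<[b]>) = 1 by apply: coprime_abel_cent_TI.
have nN0b i : b ^+ i \in 'N(N0).
  by rewrite groupX // (subsetP (commg_normr <[b]> N)) ?cycle_id.
have nUbi i : b ^+ i \in 'N(U) by rewrite groupX.
have nUN0 := subset_trans sN0N nUN; have nUN0' := subsetP nUN0.
have abN0 : abelian N0 := abelianS sN0N abN.
(* If [x] and [y] have the same image, [x * y^-1] commutes with [b ^+ i], a generator of [<[b]>], so
   it lies in the trivial group ['C_N0(<[b]>)]. *)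
have injphi i : (0 < i < p)%N ->
    {in N0 &, injective (fun x => (x^-1) ^ (b ^+ i) * x)}.
  case/andP=> i0 ip x y Nx Ny /= eqxy.
  have co_i : coprime #[b] i.
    by apply: (coprime_dvdl ob); rewrite prime_coprime // gtnNdvd.
  have gen_i : <[b]> = <[b ^+ i]>.
    by apply/eqP; move: (generator_coprime b i); rewrite co_i.
  have: x * y^-1 \in 'C_N0(<[b]>).
    rewrite inE groupM ?groupV //= gen_i cent_cycle; apply/cent1P.
    apply/commgP/conjg_fixP; rewrite conjMg conjVg.
    move: eqxy; rewrite !conjVg => /(canRL (mulKVg _)) eqx.
    by rewrite [in RHS]eqx mulgA mulgK.
  by rewrite tiN0 => /set1P/(canRL (mulgK _)); rewrite invgK mul1g.
pose F u := (\sum_(i < p) actr u (b ^+ i))%R : fmod_of abU.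
have FJ u : actr (F u) b = F u.
  rewrite /F actr_sum; case: p pr_p bp1 {F coNp ob injphi} => // p _ bp1.
  rewrite big_ord_recr big_ord_recl /= addrC -actrM // -expgSr bp1 expg0.
  by congr (_ + _)%R; apply: eq_bigr => i _; rewrite -actrM // -expgSr.
have FS u : fmval (F u) \in S.
  apply: (subsetP sCS); rewrite inE fmodP; apply/cent1P/commgP/conjg_fixP.
  by rewrite -fmvalJ // FJ.
pose G u := (\sum_(x in N0) actr (F (actr u x^-1)) x)%R : fmod_of abU.
have GS u : fmval (G u) \in S.
  rewrite /G fmval_sum group_prod // => x N0x.
  have Nx: x \in N by apply: (subsetP sN0N).
  by rewrite fmvalJ ?nUN0' // memJ_norm ?(subsetP nSN x Nx) ?FS.
pose T i u := (\sum_(y in N0) actr (actr u (b ^+ i)) y)%R : fmod_of abU.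
have TC i u : fmval (T i u) \in 'C_U(N0).
  rewrite inE fmodP; apply/centP=> x N0x; apply/commgP/conjg_fixP.
  rewrite -fmvalJ ?nUN0' // /T actr_sum [in RHS](reindex_inj (mulIg x)) /=.
  congr fmval; apply: eq_big => y; first by rewrite groupMr.
  by move=> N0y; rewrite -actrM ?nUN0'.
(* The term [i = 0] contributes [u] once for each [x] in [N0]. For [i != 0],
   [x^-1 * b ^+ i * x = b ^+ i * phi x] with [phi] a permutation of [N0], so the term is a trace
   over [N0]. *)
have Gsplit u : G u = (u *+ #|N0| + \sum_(i < p | i != 0 :> nat) T i u)%R.
  pose g i := (\sum_(x in N0) actr u (x^-1 * b ^+ i * x)%g)%R : fmod_of abU.
  have -> : G u = (\sum_(i < p) g i)%R.
    rewrite /G exchange_big /=; apply: eq_bigr => x N0x.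
    rewrite /F actr_sum; apply: eq_bigr => i _.
    have Nx := nUN0' x N0x; have Nxi : x^-1 \in 'N(U) by rewrite groupV.
    rewrite -(actrM Nxi (nUbi i)) -actrM //; last by rewrite groupM.

  rewrite (bigID (fun i : 'I_p => i == 0 :> nat)) /=; congr (_ + _)%R.
    rewrite (big_pred1 (Ordinal (prime_gt0 pr_p))) // /g.
    rewrite -sumr_const; apply: eq_bigr => x N0x.
    by rewrite expg0 mulg1 mulVg actr1.
  apply: eq_bigr => i i0; rewrite /g /T.
  have ii : (0 < i < p)%N by rewrite lt0n i0 ltn_ord.
  pose phi x := (x^-1) ^ (b ^+ i) * x.
  have im_phi : phi @: N0 = N0.
    apply/eqP; rewrite eqEcard (card_in_imset (injphi i ii)) leqnn andbT.
    by apply/subsetP=> _ /imsetP[x N0x ->]; rewrite groupM ?memJ_norm ?groupV.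
  rewrite -[in RHS]im_phi big_imset /=; last exact: injphi ii.
  apply: eq_bigr => x N0x; have Nphi : phi x \in 'N(U).
    by rewrite nUN0' // groupM // memJ_norm // groupV.
  by rewrite -(actrM (nUbi i) Nphi) /phi /conjg !mulgA mulgV mul1g.
have sUQ : U \subset S * 'C_U(N0).
  apply/subsetP=> x Ux.
  have nSC : 'C_U(N0) \subset 'N(S).
    by rewrite (subset_trans (subsetIl _ _)) // sub_abelian_norm.
  rewrite -(norm_joinEr nSC).
  have: x ^+ #|N0| \in S <*> 'C_U(N0).
    have := canRL (addrK _) (esym (Gsplit (fmod abU x))); move/(congr1 fmval).
    rewrite fmvalZ /= (fmodK abU Ux) => ->.
    have Tmem : fmval (\sum_(i < p | i != 0 :> nat) T i (fmod abU x))%R \in 'C_U(N0).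
      by rewrite fmval_sum group_prod // => i _; apply: TC.
    rewrite fmvalA fmvalN groupM //.
      by rewrite mem_gen // inE GS.
    by rewrite groupV mem_gen // inE Tmem orbT.
  have coU : coprime #|U| #|N0| by apply: coprime_dvdr (cardSg sN0N) coUN.
  by rewrite -{2}(expgK coU Ux) => /groupX->.
rewrite gen_subG; apply/subsetP=> _ /imset2P[u n Uu N0n ->].
have /mulsgP[s c Ss /setIP[Uc Cc] ->] := subsetP sUQ u Uu.
rewrite commMgJ; have /commgP/eqP-> : commute c n by apply: (centP Cc).
rewrite mulg1 memJ_norm; last by rewrite (subsetP (sub_abelian_norm abU sSU)).
by rewrite commgEl groupM ?groupV // memJ_norm // (subsetP nSN) ?(subsetP sN0N).
Qed.

Section Coprime.
Variable gT : finGroupType.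
Implicit Types (A G H J P : {group gT}) (a b : gT).

Lemma coprime_cent_prod A G :
    A \subset 'N(G) -> coprime #|G| #|A| -> solvable G ->
  [~: G, A] * 'C_G(A) = G.
Proof.
move=> nGA coGA solG; have nRA := commg_normr A G.
have sRG : [~: G, A] \subset G by rewrite commg_subl.
have nRC : 'C_G(A) \subset 'N([~: G, A]).
  by rewrite (subset_trans (subsetIl _ _)) ?commg_norml.
rewrite -quotientK // [_ / _](coprime_quotient_cent sRG) //.
rewrite (setIidPl _) ?quotientGK //; first by rewrite /normal sRG commg_norml.
by rewrite quotient_cents2r.
Qed.

Lemma coprime_commGid A G :
    A \subset 'N(G) -> coprime #|G| #|A| -> solvable G ->
  [~: G, A, A] = [~: G, A].
Proof.
move=> nGA coGA solG; rewrite -{2}(coprime_cent_prod nGA coGA solG).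
have /commG1P RC1 : 'C_G(A) \subset 'C(A) by apply: subsetIr.
have nRC : 'C_G(A) \subset 'N([~: G, A]) by rewrite (subset_trans (subsetIl _ _)) ?commg_norml.
have nAC : 'C_G(A) \subset 'N(A) by rewrite (subset_trans (subsetIr _ _)) ?cent_sub.
by rewrite [RHS]commMG ?RC1 ?mulg1 //= normsR.
Qed.

(** The derived series of [C] is climbed from its trivial term: when the next term lies in [F], it
    is centralised by [C], so the current term is a normal subgroup of class at most 2 and lies in
    [F] too. *)
Lemma solvable_cent_Fitting G : solvable G -> 'C_G('F(G)) \subset 'F(G).
Proof.
move=> solG; set F := 'F(G); set C := 'C_G(F).
have nsCG : C <| G.
  by rewrite /normal subsetIl normsI ?normG // norms_cent ?gFnorm.
suff [k Ck1] : exists k, C^`(k) = 1.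
  have sCF i : (i <= k)%N -> C^`(k - i) \subset F.
    elim: i => [_ | i IHi ltik]; first by rewrite subn0 Ck1 sub1G.
    have := IHi (ltnW ltik); rewrite -(subnSK ltik) dergSn => sRF.
    apply: Fitting_max; first exact: gFnormal_trans.
    apply/lcnP; exists 2; apply/commG1P; apply: subset_trans sRF _.
    by rewrite centsC (subset_trans (der_sub _ _)) ?subsetIr.
  by have := sCF k (leqnn k); rewrite subnn.
by have /derivedP := solvableS (normal_sub nsCG) solG.
Qed.

End Coprime.

Import GRing.Theory FinRing.Theory.
Import FiniteModule.

(** Formally, adding the norms of [u] for [a] and for the [p] elements [b * a ^+ i] counts each
    [b ^+ j * a ^+ k] once and the identity [p] extra times. The full sum is itself a sum of norms
    for [a], so [u *+ p] is a combination of fixed points, and [p] is invertible on [U]. *)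
Lemma abelian_rank2_gen_cent (gT : finGroupType) (U S : {group gT}) a b p :
    abelian U -> a \in 'N(U) -> b \in 'N(U) -> commute a b ->
    prime p -> a ^+ p = 1 -> b ^+ p = 1 -> coprime #|U| p ->
    'C_U[a] \subset S -> (forall i, 'C_U[b * a ^+ i] \subset S) ->
  U \subset S.
Proof.
move=> abU nUa nUb cab pr_p ap bp coUp sCaS sCbS; apply/subsetP=> x Ux.
pose nrm c (u : fmod_of abU) := (\sum_(j < p) actr u (c ^+ j))%R.
have nrmC c u : c \in 'N(U) -> c ^+ p = 1 -> fmval (nrm c u) \in 'C_U[c].
  move=> nUc cp; rewrite inE fmodP; apply/cent1P/commgP/conjg_fixP.
  rewrite -fmvalJ // /nrm actr_sum.
  case: p pr_p cp {ap bp coUp nrm} => // p _ cp.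
  rewrite big_ord_recr [in RHS]big_ord_recl /= addrC -actrM ?groupX // -expgSr.
  rewrite cp expg0; congr (fmval (_ + _)%R); apply: eq_bigr => i _.
  by rewrite -actrM ?groupX // -expgSr.
have nUba i : b * a ^+ i \in 'N(U) by rewrite groupM ?groupX.
have nUaX i : a ^+ i \in 'N(U) by rewrite groupX.
have nUbX i : b ^+ i \in 'N(U) by rewrite groupX.
have baX i j : (b * a ^+ i) ^+ j = b ^+ j * a ^+ (i * j).
  by rewrite expgMn -?expgM //; apply: commuteX.
have baP i : (b * a ^+ i) ^+ p = 1 by rewrite baX bp mulnC expgM ap expg1n mulg1.
set u := fmod abU x.
have sum_ij (j : nat) : (0 < j < p)%N ->
    (\sum_(i < p) actr u (b ^+ j * a ^+ (i * j)))%R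
      = nrm a (actr u (b ^+ j)).
  case/andP=> j0 jp; pose h (i : 'I_p) := Ordinal (ltn_pmod (i * j) (prime_gt0 pr_p)).
  have inj_h : injective h.
    have le_inj (i k : 'I_p) : (i <= k)%N -> h i = h k -> i = k.
      move=> leik /(congr1 val)/= /esym/eqP.
      rewrite eqn_mod_dvd ?leq_mul2r ?leik ?orbT // -mulnBl Gauss_dvdl; last first.
        by rewrite prime_coprime // gtnNdvd.
      have [/eqP|k_gt /dvdn_leq] := posnP (k - i); last first.
        by move/(_ k_gt); rewrite leqNgt (leq_ltn_trans (leq_subr i k)).
      rewrite subn_eq0 => leki _; apply: val_inj.
      by apply/eqP; rewrite eqn_leq leik.
    by move=> i k; case/orP: (leq_total i k) => le e; last apply/esym; apply: le_inj.
  rewrite /nrm [RHS](reindex_inj inj_h) /=; apply: eq_bigr => i _.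
  by rewrite /= -actrM // expg_mod.
have key : (u *+ p = \sum_(i < p) nrm (b * a ^+ i)%g u + nrm a u
           - \sum_(j < p) nrm a (actr u (b ^+ j)))%R.
  apply: (canRL (addrK _)).
  have -> : (\sum_(i < p) nrm (b * a ^+ i)%g u =
             \sum_(j < p) \sum_(i < p) actr u (b ^+ j * a ^+ (i * j))%g)%R.
    rewrite exchange_big; apply: eq_bigr => i _; apply: eq_bigr => j _.
    by rewrite baX.
  have p0 := prime_gt0 pr_p.
  rewrite (bigD1 (Ordinal p0)) //= [in RHS](bigD1 (Ordinal p0)) //= expg0 actr1.
  have -> : (\sum_(i < p) actr u (1 * a ^+ (i * 0))%g)%R = (u *+ p)%R.
    rewrite -[in RHS](card_ord p) -sumr_const; apply: eq_bigr => i _.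
    by rewrite muln0 mulg1 actr1.
  rewrite -addrA; congr (_ + _)%R; rewrite addrC; congr (_ + _)%R.
  by apply: eq_bigr => j j0; rewrite sum_ij // ltn_ord andbT lt0n.
have: x ^+ p \in S.
  have := congr1 fmval key; rewrite fmvalZ /= (fmodK abU Ux) => ->.
  have Sa v : fmval (nrm a v) \in S by rewrite (subsetP sCaS) ?nrmC.
  have Ssum (I : finType) (F : I -> fmod_of abU) :
      (forall i, fmval (F i) \in S) -> fmval (\sum_i F i)%R \in S.
    by move=> SF; rewrite fmval_sum group_prod.
  apply: groupM; last by rewrite groupV; apply: (Ssum _ _).
  apply: groupM (Sa _); apply: (Ssum _ _) => i.
  by rewrite (subsetP (sCbS i)) ?nrmC.
by move=> Sxp; rewrite -(expgK coUp Ux) groupX.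
Qed.

(** As [J] contains the derived subgroup, it is enough to generate the abelianisation of [P], where
    fixed points come from [P] by coprimeness. *)
Lemma rank2_gen_cent (gT : finGroupType) (P J : {group gT}) a b p :
    solvable P -> P^`(1) \subset J -> a \in 'N(P) -> b \in 'N(P) -> commute a b ->
    prime p -> a ^+ p = 1 -> b ^+ p = 1 -> coprime #|P| p ->
    'C_P[a] \subset J -> (forall i, 'C_P[b * a ^+ i] \subset J) ->
  P \subset J.
Proof.
move=> solP sDJ nPa nPb cab pr_p ap bp coPp sCa sCb.
have nDP : P \subset 'N(P^`(1)) := der_norm 1 P.
have nD c : c \in 'N(P) -> c \in 'N(P^`(1)).
  by apply: subsetP; apply: gFnorm_trans; apply: subxx.
have sCq c : c \in 'N(P) -> c ^+ p = 1 -> 'C_P[c] \subset J ->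
    'C_(P / P^`(1))[coset P^`(1) c] \subset J / P^`(1).
  move=> nPc cp sCJ; rewrite -cent_cycle -quotient_cycle ?nD //.
  rewrite -coprime_quotient_cent ?der_sub ?quotientS ?cent_cycle //.
    by rewrite cycle_subG nD.
  by apply: (coprime_dvdr _ coPp); rewrite order_dvdn cp.
rewrite -(quotientSGK nDP sDJ).
apply: (@abelian_rank2_gen_cent _ _ _ (coset _ a) (coset _ b) p) => //.
- exact: der_abelian.
- by rewrite (subsetP (quotient_norm _ _)) ?mem_quotient.
- by rewrite (subsetP (quotient_norm _ _)) ?mem_quotient.
- by rewrite /commute -!morphM ?nD // cab.
- by rewrite -morphX ?nD // ap morph1.
- by rewrite -morphX ?nD // bp morph1.
- exact: coprime_morphl.
- exact: sCq.
move=> i; rewrite -morphX ?nD // -morphM ?groupX ?nD // sCq //.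
  by rewrite groupM ?groupX.
by rewrite expgMn ?bp -?expgM 1?mulnC ?expgM ?ap ?expg1n ?mulg1 //; apply: commuteX.
Qed.

(** A Sylow [p]-subgroup of [L] lies in some [A :^ r0], so each given [b ^ x] lies in some
    [A :^ (r0 * l)] with [l] in [L]. Elements of [A] conjugate in [R <*> A] are equal, since they
    agree modulo [R]; as ['C_R[b]] centralises [A], this forces [A :^ x = A :^ (r0 * l)]. Hence each
    [r] in [R] differs from some [l] in [L] by an element normalising [A :^ r0], which commutators
    with powers of [b ^ r0] do not see; and these commutators generate [R]. *)
Lemma sub_of_conj_meet (gT : finGroupType) (p : nat) (R A L : {group gT}) (B : {set gT}) :
    p.-group A -> p^'.-group R -> abelian A -> A \subset 'N(R) ->
    L \subset R <*> A -> B \subset A ->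
    {in B, forall b, 'C_R[b] \subset 'C(A)} ->
    {in B, forall b, R \subset [~: R, <[b]>]} ->
    {in R, forall x, exists2 b, b \in B & b ^ x \in L} ->
  R \subset L.
Proof.
move=> pA p'R abA nRA sLRA sBA cRB RB BL.
have defRA : R <*> A = R * A by rewrite norm_joinEr.
have tiRA : R :&: A = 1.
  by rewrite coprime_TIg // coprime_sym (pnat_coprime pA).
have sylA : p.-Sylow(R <*> A) A.
  rewrite /pHall joing_subr pA /= -divgS ?joing_subr //= defRA.
  by rewrite TI_cardMg // mulnK ?cardG_gt0.
have [S sylS] := Sylow_exists p L.
have pS := pHall_pgroup sylS; have sSL := pHall_sub sylS.
have [y RAy sSAy] := Sylow_Jsub sylA (subset_trans sSL sLRA) pS.
have nRRA : R <*> A \subset 'N(R) by rewrite join_subG normG.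
have Rab u a : u \in R <*> A -> a \in A -> [~ u, a] \in R.
  rewrite defRA => /mulsgP[r c Rr Ac ->] Aa; rewrite commMgJ.
  have /commgP/eqP-> : commute c a by apply: (centsP abA).
  rewrite mulg1 memJ_norm ?(subsetP nRA) // commgEl groupM ?groupV //.
  by rewrite memJ_norm // (subsetP nRA).
have [r0 Rr0 {y RAy sSAy}sSA] : exists2 r, r \in R & S \subset A :^ r.
  have: y^-1 \in A * R by rewrite (normC nRA) -defRA groupV.
  case/mulsgP=> a r Aa Rr defy; exists r => //.
  by rewrite -(conjGid Aa) -conjsgM -defy -sub_conjgV invgK.
have AxL x : x \in R -> exists2 l, l \in L & A :^ x = A :^ (r0 * l).
  move=> Rx; have [b Bb Lbx] := BL x Rx; have Ab := subsetP sBA b Bb.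
  have pbx : p.-group <[b ^ x]> by rewrite cycleJ pgroupJ; apply: mem_p_elt pA _.
  have sbL : <[b ^ x]> \subset L by rewrite cycle_subG.
  have [l Ll sbS] := Sylow_subJ sylS sbL pbx.
  exists l => //; set u := r0 * l * x^-1.
  have RAu : u \in R <*> A.
    have sR := subsetP (joing_subl R A).
    by rewrite !groupM ?groupV ?(sR _ Rr0) ?(sR _ Rx) ?(subsetP sLRA).
  have /imsetP[c Ac defb] : b ^ x \in A :^ (r0 * l).
    by rewrite conjsgM -cycle_subG (subset_trans sbS) ?conjSg.
  have {}defb : b = c ^ u by rewrite [RHS]conjgM -defb conjgK.
  have ebc : b = c.
    apply/eqP; rewrite eq_sym eq_mulVg1 -in_set1 -set1gE -tiRA.
    apply/setIP; split; last by rewrite groupM ?groupV.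
    by rewrite defb -commgEl -invg_comm groupV Rab.
  have Nu : u \in 'N(A).
    have: u \in A * R by rewrite (normC nRA) -defRA.
    case/mulsgP=> a r Aa Rr defu; rewrite defu groupM ?(subsetP (normG A) a Aa) //.
    apply: (subsetP (cent_sub A)); apply: (subsetP (cRB b Bb)).
    rewrite inE Rr; apply/cent1P; apply: commute_sym; apply/commgP/conjg_fixP.
    have ba : b ^ a = b by apply/conjg_fixP/commgP; apply: (centsP abA).
    by rewrite -{1}ba -conjgM -defu [in RHS]defb ebc.
  by rewrite -[in RHS](mulgKV x (r0 * l)) conjsgM (normP Nu).
have [b Bb Lbr] := BL r0 Rr0; have Ab := subsetP sBA b Bb.
have defR : R \subset [~: R, <[b ^ r0]>].
  by rewrite cycleJ -(conjGid Rr0) -conjsRg conjSg RB.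
apply: (subset_trans defR); rewrite gen_subG.
apply/subsetP=> _ /imset2P[r z Rr bz ->].
have [l Ll eAl] := AxL (r0 * r) (groupM Rr0 Rr).
have Lz : z \in L by apply: subsetP bz; rewrite cycle_subG.
have Az : z \in A :^ r0.
  by apply: subsetP bz; rewrite cycle_subG memJ_conjg.
have cgz : [~ r * l^-1, z] = 1.
  apply/eqP; rewrite -in_set1 -set1gE.
  have <- : R :&: A :^ r0 = 1.
    by rewrite -{1}(conjGid Rr0) -conjIg tiRA conjs1g.
  have Ng : r * l^-1 \in 'N(A :^ r0).
    by apply/normP; rewrite -conjsgM mulgA conjsgM eAl conjsgM conjsgK.
  have RAg : (r * l^-1) \in R <*> A.
    by rewrite groupM ?groupV ?(subsetP sLRA l Ll) ?(subsetP (joing_subl R A) r Rr).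
  apply/setIP; split; last by rewrite commgEr groupM // memJ_norm // groupV.
  case/imsetP: Az => c Ac ->; rewrite -(conjgKV r0 (r * _)) -conjRg.
  rewrite memJ_norm ?(subsetP (normG R)) // Rab // groupJ ?groupV //.
  exact: (subsetP (joing_subl R A)).
by rewrite -(mulgKV l r) commMgJ cgz conj1g mul1g groupR.
Qed.

Lemma comm_cycle_sub (gT : finGroupType) (N K : {group gT}) c :
    N \subset 'N(K) -> c \in 'N(N) ->
    {in N, forall n, [~ n, c] \in K} -> c \in 'N(K) ->
  [~: N, <[c]>] \subset K.
Proof.
move=> nKN nNc NcK nKc.
have nKC : <[c]> \subset 'N(K) by rewrite cycle_subG.
rewrite -quotient_cents2 // quotient_cycle // cent_cycle.
apply/subsetP=> _ /morphimP[n nKn Nn ->]; apply/cent1P/commgP.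
by rewrite -morphR //; apply/eqP; apply: coset_id; apply: NcK.
Qed.

(** * Symmetrised products and abelian subgroups moved by an operator *)

Section TwistedSquares.

(* [tw e y n] plays the role of y (n + e n^-1) in the N-module U; it is used
   with e = 1 if p is odd and e = -1 if p = 2. *)
Definition tw (gT : finGroupType) e (y n : gT) := y ^ n * (y ^ n^-1) ^+ e.

Implicit Type gT : finGroupType.

Lemma tw_conj gT e (y n b : gT) : tw e (y ^ b) (n ^ b) = tw e y n ^ b.
Proof. by rewrite /tw [RHS]conjMg [in RHS]conjXg -conjVg -!conjJg. Qed.

(** The commutator [g n m] of [y ^ n] and [y ^ m] is unchanged when [n] and [m] are multiplied by
    the same element of [N], and inverted when they are exchanged. So [g n m^-1] is inverse to
    [g n^-1 m], and [g n^-1 m^-1] to [g n m]: the four factors of the expanded commutator cancel in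
    pairs once [e * e] acts as 1. *)
Lemma comm_class2_tw gT (Q N : {group gT}) e y :
    [~: Q, Q] \subset 'C(Q) -> [~: Q, Q] \subset 'C(N) -> abelian N ->
    N \subset 'N(Q) -> y \in Q -> {in Q, forall x, x ^+ (e * e) = x} ->
  {in N &, forall n m, commute (tw e y n) (tw e y m)}.
Proof.
move=> cQ cN abN nQN Qy ee n m Nn Nm.
have QJ x : x \in N -> y ^ x \in Q by move=> Nx; rewrite memJ_norm ?(subsetP nQN).
have cR u v w : u \in Q -> v \in Q -> w \in Q -> commute [~ u, v] w.
  by move=> Qu Qv Qw; apply: (centsP cQ) => //; apply: mem_commg.
have JR u v x : u \in Q -> v \in Q -> x \in N -> [~ u, v] ^ x = [~ u, v].
  move=> Qu Qv Nx; apply/conjg_fixP/commgP; apply: (centsP cN) => //.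
  exact: mem_commg.
have RMl u v w : u \in Q -> v \in Q -> w \in Q ->
    [~ u * v, w] = [~ u, w] * [~ v, w].
  move=> Qu Qv Qw; rewrite commMgJ; congr (_ * _).
  by apply/conjg_fixP/commgP; apply: cR.
have RMr u v w : u \in Q -> v \in Q -> w \in Q ->
    [~ w, u * v] = [~ w, u] * [~ w, v].
  move=> Qu Qv Qw; rewrite commgMJ; have /commgP/conjg_fixP->: commute [~ w, u] v.
    by apply: cR.
  by apply: cR => //; rewrite groupR.
have RXl u w i : u \in Q -> w \in Q -> [~ u ^+ i, w] = [~ u, w] ^+ i.
  move=> Qu Qw; apply: commXg; apply: commute_sym; exact: cR.
have RXr u w i : u \in Q -> w \in Q -> [~ w, u ^+ i] = [~ w, u] ^+ i.
  move=> Qu Qw; apply: commgX; apply: commute_sym; exact: cR.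
pose g n m := [~ y ^ n, y ^ m].
have gE a b c : a \in N -> b \in N -> c \in N -> g a b = g (a * c) (b * c).
  by move=> Na Nb Nc; rewrite /g !conjgM -conjRg JR ?QJ.
have gV a b : a \in N -> b \in N -> g a b = (g b a)^-1.
  by move=> Na Nb; rewrite /g invg_comm.
have g1 : g n m^-1 = (g n^-1 m)^-1.
  rewrite (@gE n m^-1 (n^-1 * m)) ?groupM ?groupV // mulKVg.
  by rewrite (centsP abN n^-1) ?groupV // mulKg gV ?groupV.
have g2 : g n^-1 m^-1 = (g n m)^-1.
  rewrite (@gE _ _ (n * m)) ?groupM ?groupV // mulKg.
  by rewrite (centsP abN n) // mulKg gV.
have QV x : x \in N -> y ^ x^-1 \in Q by move=> Nx; rewrite QJ ?groupV.
have [Qn Qm] := (QJ n Nn, QJ m Nm); have [Qn' Qm'] := (QV n Nn, QV m Nm).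
have [Qne Qme] := (groupX e Qn', groupX e Qm').
have Qt : y ^ m * (y ^ m^-1) ^+ e \in Q by apply: (groupM Qm Qme).
apply/commgP/eqP; rewrite /tw (RMl _ _ _ Qn Qne Qt) !(RMr _ _ _ Qm Qme) //.
rewrite (RXl _ _ _ Qn' Qm) (RXl _ _ _ Qn' Qme) (RXr _ _ _ Qm' Qn) (RXr _ _ _ Qm' Qn').
rewrite -/(g n m) -/(g n m^-1) -/(g n^-1 m) -/(g n^-1 m^-1) g1 g2 expgVn.
have eg : g n m ^+ (e * e) = g n m by apply: ee; rewrite groupR.
rewrite -expgM expgVn eg mulgA mulgKV mulgV //.
Qed.

(** In a minimal [N0]-invariant [X] inside [[~: U, N0]], written additively with [m = n ^ b], one
    gets [x n + e x n^-1 = x m + e x m^-1], so that [w = x m - x n] satisfies [w = e w (n m)^-1].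
    For [e = 1], a nonzero [w] makes [n m] trivial on [X]; for sign [-1], odd orders force [w = 0].
    Either way [N0] ends up trivial on [X], which is absurd. *)
Lemma comm_trivial_of_tw_fixed gT (U N : {group gT}) b p e :
    abelian U -> abelian N -> N \subset 'N(U) -> b \in 'N(U) -> b \in 'N(N) ->
    prime p -> b ^+ p = 1 -> coprime #|N| p -> coprime #|U| #|N| ->
    e = 1%N /\ odd p \/
    [/\ p = 2, odd #|U| & {in U, forall x, x ^+ e = x^-1}] ->
    {in 'C_U[b] & N, forall y n, tw e y n ^ b = tw e y n} ->
  [~: N, <[b]>] \subset 'C(U).
Proof.
move=> abU abN nUN nUb nNb pr_p bp1 coNp coUN he fix_tw.
have nNB : <[b]> \subset 'N(N) by rewrite cycle_subG.
set N0 := [~: N, <[b]>]%G.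
have sN0N : N0 \subset N by rewrite commg_subl.
have nN0b : b \in 'N(N0) by rewrite -cycle_subG commg_normr.
have nUN0 := subset_trans sN0N nUN; have abN0 : abelian N0 := abelianS sN0N abN.
have coUN0 : coprime #|U| #|N0| by rewrite (coprimegS sN0N).
have ob : #[b] %| p by rewrite order_dvdn bp1.
have coNb : coprime #|N| #|<[b]>| by apply: coprime_dvdr coNp.
have N0N0 : [~: N0, <[b]>] = N0.
  by rewrite /N0 /= coprime_commGid ?abelian_sol.
have UJ x u : u \in U -> x \in N -> u ^ x \in U.
  by move=> Uu Nx; rewrite memJ_norm ?(subsetP nUN).
have cU := centsP abU.
have mACA (x y z t : gT) : commute y z -> x * y * (z * t) = x * z * (y * t).
  by move=> cyz; rewrite -!mulgA; congr (_ * _); rewrite !mulgA cyz.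
have twM n : n \in N -> {in U &, {morph (tw e)^~ n : x y / x * y}}.
  move=> Nn x y Ux Uy; rewrite /tw !conjMg expgMn; last first.
    by apply: cU; rewrite UJ ?groupV.
  apply: mACA; apply: cU; first exact: UJ.
  by rewrite groupX ?UJ ?groupV.
have Utw n y : n \in N -> y \in U -> tw e y n \in U.
  by move=> Nn Uy; rewrite groupM ?groupX ?UJ ?groupV.
have twJ n x y : n \in N -> x \in N -> tw e (y ^ x) n = tw e y n ^ x.
  move=> Nn Nx; rewrite /tw [RHS]conjMg [in RHS]conjXg -!conjgM.
  by rewrite !(centsP abN x) ?groupV.
have twJb n y : tw e (y ^ b) (n ^ b) = tw e y n ^ b := tw_conj e y n b.
(* This condition is additive in [u] and invariant under [N] and [b], and holds on ['C_U[b]] by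
   hypothesis; so [comm_sub_of_cent_sub] extends it to [[~: U, N0]]. *)
pose S := [set u in U | [forall n in N, tw e u n == tw e u (n ^ b)]].
have SP u : reflect (u \in U /\ {in N, forall n, tw e u n = tw e u (n ^ b)})
                    (u \in S).
  rewrite inE; apply: (iffP andP) => [] [-> h]; split=> //.
    by move=> n Nn; apply/eqP; apply: (forall_inP h).
  by apply/forall_inP=> n Nn; apply/eqP/h.
have gS : group_set S.
  apply/group_setP; split=> [|u v /SP[Uu hu] /SP[Uv hv]].
    by apply/SP; split=> // n Nn; rewrite /tw !conj1g.
  apply/SP; split=> [|n Nn]; first exact: groupM.
  by rewrite !twM ?memJ_norm // -(hu n Nn) -(hv n Nn).
pose Sg := Group gS.
have nSN : N \subset 'N(Sg).
  apply/subsetP=> x Nx; rewrite inE; apply/subsetP=> _ /imsetP[u /SP[Uu hu] ->].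
  by apply/SP; split=> [|n Nn]; rewrite ?UJ // !twJ ?memJ_norm // -(hu n Nn).
have nSb : b \in 'N(Sg).
  rewrite inE; apply/subsetP=> _ /imsetP[u /SP[Uu hu] ->].
  apply/SP; split=> [|n Nn]; first by rewrite memJ_norm.
  have Nn' : n ^ b^-1 \in N by rewrite memJ_norm ?groupV.
  by rewrite -(conjgKV b n) !twJb -(hu _ Nn').
have sCS : 'C_U[b] \subset Sg.
  apply/subsetP=> y Cy; have [Uy cy] := setIP Cy.
  apply/SP; split=> // n Nn; rewrite -(fix_tw y n Cy Nn) -twJb; congr tw.
  by apply/conjg_fixP/commgP/cent1P.
have sSU : Sg \subset U by apply/subsetP=> u /SP[].
have sUN0S := comm_sub_of_cent_sub abU abN nUN nUb nNb pr_p bp1 coNp coUN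
  sSU nSN nSb sCS.
apply: contraT => ncN0.
have ntUN0 : [~: U, N0] != 1 by apply: contra ncN0 => /eqP/commG1P; rewrite centsC.
have [X minX sXU] : {X | [min X | (X :!=: 1) && (N0 \subset 'N(X))]
                     & X \subset [~: U, N0]}.
  by apply: mingroup_exists; rewrite ntUN0 commg_normr.
have [/andP[ntX nXN0] X_min] := mingroupP minX.
have sXU' : X \subset U by apply: subset_trans sXU _; rewrite commg_subl.
have sXS : X \subset S by apply: subset_trans sXU sUN0S.
have nXJ x u : u \in X -> x \in N0 -> u ^ x \in X.
  by move=> Xu Nx; rewrite memJ_norm ?(subsetP nXN0).
have cX x w : x \in N0 -> w \in X -> w != 1 -> commute w x -> x \in 'C(X).
  move=> N0x Xw ntw cwx; have: 'C_X[x] = X.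
    apply: X_min; last exact: subsetIl.
    apply/andP; split.
      by apply/trivgPn; exists w => //; rewrite inE Xw; apply/cent1P/commute_sym.
    rewrite normsI // (subset_trans _ (normG _)) //.
    by rewrite sub_cent1 (subsetP abN0).
  by move/setIidPl; rewrite sub_cent1.
have mk n x : n \in N0 -> x \in X ->
    let w := (x ^ n)^-1 * x ^ (n ^ b) in w = (w ^ (n * n ^ b)^-1) ^+ e.
  move=> N0n Xx /=.
  have [Ux Nn] : x \in U /\ n \in N by rewrite (subsetP sXU') ?(subsetP sN0N).
  have Nnb : n ^ b \in N by rewrite memJ_norm.
  have /SP[_ /(_ n Nn)] := subsetP sXS x Xx.
  rewrite /tw => /(congr1 (mulg (x ^ n)^-1)); rewrite mulKg mulgA.
  move/(canLR (mulgK _)) => {1}<-.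
  rewrite [in RHS]conjMg [in RHS]conjVg -!conjgM.
  have -> : n * (n * n ^ b)^-1 = (n ^ b)^-1.
    by rewrite (centsP abN n Nn (n ^ b) Nnb) invgM mulKVg.
  have -> : n ^ b * (n * n ^ b)^-1 = n^-1 by rewrite invgM mulKVg.
  have [U1 U2] : x ^ n^-1 \in U /\ x ^ (n ^ b)^-1 \in U by rewrite !UJ ?groupV.
  rewrite [RHS]expgMn; last by apply: cU; rewrite ?groupV.
  by rewrite expgVn; apply: cU; rewrite ?groupV ?groupX.
have triv c : c \in 'N(N0) -> <[b]> \subset <[c]> ->
    {in N0, forall n, [~ n, c] \in 'C(X)} -> false.
  move=> nN0c sbc h; have N0X : N0 \subset 'C(X).
    apply: subset_trans (_ : [~: N0, <[b]>] \subset _); first by rewrite N0N0.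
    rewrite (subset_trans (commgS _ sbc)) //.
    have nNc : <[c]> \subset 'N(N0) by rewrite cycle_subG.
    apply: subset_trans (subsetIr N0 _).
    have cN0 n : n \in N0 -> [~ n, c] \in 'C_N0(X).
      move=> N0n; rewrite inE h // andbT (subsetP (_ : [~: N0, <[c]>] \subset _)) //.
        by rewrite commg_subl.
      by rewrite mem_commg // cycle_id.
    apply: comm_cycle_sub => //.
      by rewrite sub_abelian_norm ?subsetIl.
    rewrite inE; apply/subsetP=> _ /imsetP[k Ck ->].
    by rewrite conjg_mulR groupM // cN0 //; case/setIP: Ck.
  have: X \subset 'C_[~: U, N0](N0) by rewrite subsetI sXU centsC.
  by rewrite coprime_abel_cent_TI // subG1 (negPf ntX).
have N0b n : n \in N0 -> n ^ b \in N0 by rewrite memJ_norm.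
have cm n : n \in N0 -> ([~ n, b] \notin 'C(X)) -> 
    exists2 w, w \in X :\ 1 & w = (w ^ (n * n ^ b)^-1) ^+ e.
  move=> N0n; rewrite commgEl => ncX.
  have /subsetPn[x Xx ncx] : ~~ (X \subset 'C[n^-1 * n ^ b]) by rewrite sub_cent1.
  have Xxn : x ^ n^-1 \in X by rewrite nXJ ?groupV.
  exists ((x ^ n)^-1 * x ^ (n ^ b)); last exact: mk.
  rewrite !inE groupM ?groupV ?nXJ ?N0b // andbT.
  apply: contra ncx => /eqP/(canRL (mulKg _)); rewrite mulg1 invgK => eqx.
  apply/cent1P/commgP/conjg_fixP.
  by rewrite (centsP abN0) ?groupV ?N0b // conjgM eqx conjgK.
case: he => [[e1 op] | [p2 oU einv]]; last first.
  apply: (triv b) => // n N0n; apply: contraT => /(cm n N0n)[w /setD1P[ntw Xw]].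
  set k := n * n ^ b => defw.
  have N0k : k \in N0 by rewrite groupM ?N0b.
  have Xwk : w ^ k^-1 \in X by rewrite nXJ ?groupV.
  have wk : w ^ k = w^-1.
    by rewrite {1}defw einv ?(subsetP sXU') // conjVg conjgKV.
  have wk2 : w ^ (k ^+ 2) = w by rewrite expgS conjgM wk conjVg wk invgK.
  have ok : odd #[k].
    have: #[k] %| #|N| by apply: order_dvdG; apply: (subsetP sN0N).
    by move/dvdn_odd; apply; rewrite -coprimen2 -p2.
  have cwk : commute w k.
    have: k \in <[k ^+ 2]>.
      have: generator <[k]> (k ^+ 2) by rewrite generator_coprime coprimen2.
      by move/eqP=> <-; apply: cycle_id.
    case/cycleP=> i ->; apply: commuteX.
    by apply/commgP/conjg_fixP.
  move: wk; have /commgP/conjg_fixP-> := cwk => /eqP.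
  rewrite eq_sym eq_invg_mul => ww1; case/negP: ntw.
  have: w \in <[w ^+ 2]>.
    have ow : odd #[w].
      have: #[w] %| #|U| by apply: order_dvdG; apply: (subsetP sXU').
      by move/dvdn_odd; apply.
    have: generator <[w]> (w ^+ 2) by rewrite generator_coprime coprimen2.
    by move/eqP=> <-; apply: cycle_id.
  by rewrite expgS expg1 (eqP ww1) cycle1 inE.
have alt n : n \in N0 -> [~ n, b] \notin 'C(X) -> n * n ^ b \in 'C(X).
  move=> N0n /(cm n N0n)[w /setD1P[ntw Xw]]; rewrite e1 expg1 => defw.
  have N0k : n * n ^ b \in N0 by rewrite groupM ?N0b.
  rewrite -groupV; apply: (cX _ w) => //; first by rewrite groupV.
  by apply/commgP/conjg_fixP.
(* For each [n], either [[~ n, b]] or [n * n ^ b] is trivial on [X]. Both are homomorphic in [n],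
   and a group is not the union of two proper subgroups, so one alternative holds throughout. *)
have [all1 | ] := boolP [forall n in N0, [~ n, b] \in 'C(X)].
  by apply: (triv b) => //; apply/forall_inP.
case/forall_inPn=> n0 N0n0 nc0.
have all2 n : n \in N0 -> n * n ^ b \in 'C(X).
  move=> N0n; have [cn | ] := boolP ([~ n, b] \in 'C(X)); last exact: alt.
  have N0m : n0 * n \in N0 by rewrite groupM.
  have cN0 := centsP abN0.
  have ncm : [~ n0 * n, b] \notin 'C(X).
    have -> : [~ n0 * n, b] = [~ n0, b] * [~ n, b].
      rewrite commMgJ; congr (_ * _); apply/conjg_fixP/commgP.
      by apply: cN0; rewrite // commgEl groupM ?groupV ?N0b.
    by rewrite groupMr.
  have := alt _ N0m ncm; have c0 := alt _ N0n0 nc0.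
  rewrite conjMg mACA; last by apply: cN0; rewrite ?N0b.
  by rewrite groupMl.
(* Here [b] inverts [N0] modulo the centraliser of [X], so [b ^+ 2] acts trivially on it; for odd
   [p] it generates [<[b]>]. *)
apply: (triv (b ^+ 2)).
- exact: groupX.
- have [-> | ntb] := eqVneq b 1; first by rewrite cycle1 sub1G.
  have: generator <[b]> (b ^+ 2).
    rewrite generator_coprime coprimen2; apply: dvdn_odd op.
    exact: ob.
  by move/eqP->.
move=> n N0n; rewrite commgEl expgS expg1 conjgM.
suff -> : n^-1 * (n ^ b) ^ b = (n * n ^ b)^-1 * (n ^ b * (n ^ b) ^ b).
  by rewrite groupM ?groupV ?all2 ?N0b.
rewrite invMg (centsP abN0 (n ^ b)^-1) ?groupV ?N0b //.
by rewrite -[RHS]mulgA mulKg.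
Qed.

(** For [y] fixed by [b], the [tw e y n] commute and are permuted by [b]. If [b] fixed them all for
    every such [y], then [[~: N, <[b]>]] would centralise the abelianisation of [Q], hence [Q]
    itself, because [N] centralises the derived subgroup and acts coprimely. *)
Lemma twisted_subgroup_exists gT (Q N : {group gT}) b p :
    solvable Q -> abelian N -> N \subset 'N(Q) -> b \in 'N(Q) -> b \in 'N(N) ->
    prime p -> b ^+ p = 1 -> coprime #|N| p -> coprime #|Q| p ->
    coprime #|Q| #|N| ->
    [~: Q, Q] \subset 'C(Q) -> [~: Q, Q] \subset 'C(N) ->
    ~~ ([~: N, <[b]>] \subset 'C(Q)) ->
  exists M : {group gT},
    [/\ M \subset Q, abelian M, b \in 'N(M) & ~~ (M \subset 'C[b])].
Proof.
move=> solQ abN nQN nQb nNb pr_p bp1 coNp coQp coQN cQQ cQN ncQ.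
(* Exponents are natural numbers: [#|Q|.-1] plays the role of [-1]. *)
pose e := if odd p then 1%N else #|Q|.-1.
have Q0 : (0 < #|Q|)%N := cardG_gt0 Q.
have QX x : x \in Q -> ~~ odd p -> x ^+ e = x^-1.
  move=> Qx /negPf op; rewrite /e op; apply/eqP.
  by rewrite eq_sym eq_invg_mul -expgS prednK // expg_cardG.
have ee : {in Q, forall x, x ^+ (e * e) = x}.
  move=> x Qx; rewrite expgM; have [op | op] := boolP (odd p).
    by rewrite /e op.
  by rewrite !QX ?groupV ?invgK.
pose M y := <<[set tw e y n | n in N]>>%G.
have QM y : y \in Q -> M y \subset Q.
  move=> Qy; rewrite gen_subG; apply/subsetP=> _ /imsetP[n Nn ->].
  by rewrite groupM ?groupX ?memJ_norm ?groupV ?(subsetP nQN).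
have abM y : y \in Q -> abelian (M y).
  move=> Qy; rewrite /abelian cent_gen gen_subG; apply/centsP.
  move=> _ /imsetP[n Nn ->] _ /imsetP[m Nm ->].
  exact: (comm_class2_tw cQQ cQN abN nQN Qy ee).
have twb y n : y \in 'C[b] -> tw e y n ^ b = tw e y (n ^ b).
  move=> /cent1P cyb; have yb : y ^ b = y by apply/conjg_fixP/commgP/commute_sym.
  by rewrite -tw_conj yb.
have nMb y : y \in 'C[b] -> b \in 'N(M y).
  move=> cy; rewrite inE -genJ gen_subG; apply/subsetP=> _ /imsetP[_ /imsetP[n Nn ->] ->].
  by rewrite twb // mem_gen // imset_f // memJ_norm.
have [/exists_inP[y /setIP[Qy cy] ncM] | all_c] :=
    boolP [exists y in 'C_Q[b], ~~ (M y \subset 'C[b])].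
  by exists (M y); rewrite QM ?abM ?nMb.
case/negP: ncQ; set N0 := [~: N, <[b]>]%G.
have sN0N : N0 \subset N by rewrite commg_subl cycle_subG.
pose D := (Q^`(1))%G; have nDP : Q \subset 'N(D) := der_norm 1 Q.
have nD (X : {set gT}) : X \subset 'N(Q) -> X \subset 'N(D) by apply: gFnorm_trans.
have nDN := nD _ nQN; have nDb : b \in 'N(D) by rewrite -sub1set nD ?sub1set.
have nDB : <[b]> \subset 'N(D) by rewrite cycle_subG.
have cob : coprime #|Q| #|<[b]>| by apply: coprime_dvdr coQp; rewrite order_dvdn bp1.
have QN0 : [~: Q, N0] \subset D.
  have: [~: (N / D), <[coset D b]>] \subset 'C(Q / D).
    apply: (@comm_trivial_of_tw_fixed _ _ _ _ p e) => //.
    - exact: der_abelian.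
    - exact: quotient_abelian.
    - exact: quotient_norms.
    - by rewrite (subsetP (quotient_norm _ _)) ?mem_quotient.
    - by rewrite (subsetP (quotient_norm _ _)) ?mem_quotient.
    - by rewrite -morphX // bp1 morph1.
    - exact: coprime_morphl.
    - by rewrite coprime_morphl ?coprime_morphr.
    - have [op | op] := boolP (odd p); [left | right].
        by rewrite /e op.
      have p2 : p = 2 by case/even_prime: pr_p => // /idPn[]; rewrite op.
      split=> //.
        have oQ : odd #|Q| by rewrite -coprimen2 -p2.
        by apply: dvdn_odd oQ; apply: dvdn_morphim.
      move=> _ /morphimP[x nDx Qx ->]; rewrite -morphX //= QX //.
      by rewrite morphV.
    move=> y n; rewrite -cent_cycle -quotient_cycle //.
    rewrite -coprime_quotient_cent ?der_sub // => /morphimP[{}y nDy Cy ->].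
    case/morphimP=> {}n nDn Nn ->; have [Qy cy] := setIP Cy.
    have cty : tw e y n ^ b = tw e y n.
      move: all_c => /exists_inPn/(_ y); rewrite cent_cycle in Cy.
      move=> /(_ Cy)/negPn/subsetP/(_ (tw e y n)) cM.
      apply/conjg_fixP/commgP; apply/cent1P; apply: cM.
      by rewrite mem_gen // imset_f.
    have tw_coset : coset D (tw e y n) = tw e (coset D y) (coset D n).
      by rewrite /tw morphM ?groupX ?groupJ ?groupV // morphX ?groupJ ?groupV //
                 !morphJ ?groupV // morphV.
    rewrite -tw_coset -morphJ ?cty //.
    by rewrite groupM ?groupX ?groupJ ?groupV.
  have nDN0 := subset_trans sN0N nDN.
  by rewrite -quotient_cycle // -quotientR // quotient_cents2 // commGC.
have RN0 : [~: Q, N0, N0] = 1.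
  apply/commG1P; rewrite centsC (subset_trans sN0N) // centsC.
  by rewrite (subset_trans QN0).
have nQN0 := subset_trans sN0N nQN.
have coQN0 : coprime #|Q| #|N0| := coprimegS sN0N coQN.
by rewrite centsC; apply/commG1P; rewrite -(coprime_commGid nQN0).
Qed.

End TwistedSquares.

(** * Fitting height and iterated commutators *)

Section LowerNilpotentSeries.

(** For [m] at least all the nilpotency classes involved, such as [#|gT|], this is the [n]-th
    iterated nilpotent residual. One [m] for all steps makes Fitting height at most [n] a decidable
    condition, compatible with subgroups and morphisms. *)
Definition lnil (gT : finGroupType) m n (G : {group gT}) : {group gT} :=
  iter n (fun K : {group gT} => 'L_m.+1(K)%G) G.

Implicit Type gT : finGroupType.

Lemma lnilS gT m n (G H : {group gT}) :
  G \subset H -> lnil m n G \subset lnil m n H.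
Proof. by move=> sGH; elim: n => //= n IHn; apply: lcnS. Qed.

Lemma lnil_morphim gT (rT : finGroupType) (D : {group gT}) (f : {morphism D >-> rT}) m n
    (G : {group gT}) :
  G \subset D -> f @* lnil m n G = lnil m n (f @* G).
Proof.
move=> sGD; elim: n => //= n IHn.
have sLD : lnil m n G \subset D.
  apply: subset_trans sGD; rewrite {IHn}; elim: n => //= n IHn.
  exact: subset_trans (lcn_sub _ _) IHn.
by rewrite morphim_lcn // IHn.
Qed.

Lemma lnil_char gT m n (G : {group gT}) : lnil m n G \char G.
Proof.
elim: n => [|n IHn]; first exact: char_refl.
by apply: char_trans IHn; apply: lcn_char.
Qed.

Lemma lnil_of_fitting_height gT (G : {group gT}) n :
  fitting_height_le G n -> lnil #|gT| n G = 1%G.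
Proof.
case=> f [f0 fn f_nil]; apply/trivGP.
have sub i : (i <= n)%N -> lnil #|gT| i G \subset f (n - i).
  elim: i => [_ | i IHi ltin] /=; first by rewrite subn0 fn.
  have ltn' : (n - i.+1 < n)%N by rewrite ltn_subrL (leq_ltn_trans _ ltin).
  have [nfG sff nil_f] := f_nil _ ltn'; move: sff nil_f.
  have -> : (n - i.+1).+1 = (n - i)%N by rewrite subnSK.
  move=> sff nil_f; apply: subset_trans (lcnS _ (IHi (ltnW ltin))) _.
  have nff : f (n - i)%N \subset 'N(f (n - i.+1)%N).
    have sfG : f (n - i)%N \subset G.
      have [i0 | i0] := posnP i; first by rewrite i0 subn0 fn.
      have ltn2 : (n - i < n)%N by rewrite ltn_subrL i0 (leq_trans _ ltin).
      by have [/andP[]] := f_nil _ ltn2.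
    exact: subset_trans sfG (normal_norm nfG).
  rewrite -quotient_sub1 ?(subset_trans (lcn_sub _ _)) //.
  rewrite [_ / _]morphim_lcn // subG1; apply/eqP/lcn_nil_classP => //.
  move: (nil_f); rewrite nilpotent_class => /ltnW/leq_trans->//.
  exact: leq_trans (leq_quotient _ _) (max_card _).
by have := sub n (leqnn n); rewrite subnn f0.
Qed.

Lemma fitting_height_lnil gT (G : {group gT}) n :
  fitting_height_le G n <-> exists m, lnil m n G = 1%G.
Proof.
split=> [/lnil_of_fitting_height|[m Gn1]]; first by exists #|gT|.
exists (fun i => lnil m (n - i) G); split=> [||i ltin].
- by rewrite subn0 Gn1.
- by rewrite subnn.
have -> : (n - i = (n - i.+1).+1)%N by rewrite subnSK.
split; first exact/char_normal/lnil_char.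
  exact: lcn_sub.
apply/lcnP; exists m => /=.
by rewrite -[LHS]morphim_lcn ?lcn_norm //; apply: trivg_quotient.
Qed.

Lemma fitting_height_le_dec gT (G : {group gT}) n :
  fitting_height_le G n \/ ~ fitting_height_le G n.
Proof.
have [Gn1 | ntGn] := eqVneq (lnil #|gT| n G) 1%G.
  by left; apply/fitting_height_lnil; exists #|gT|.
by right=> /lnil_of_fitting_height Gn1; rewrite Gn1 eqxx in ntGn.
Qed.

Lemma sub_lcn gT (K X Y : {group gT}) m :
  X \subset K -> Y \subset K -> X \subset [~: X, Y] -> X \subset 'L_m.+1(K).
Proof.
move=> sXK sYK sXR; elim: m => // m IHm.
by rewrite lcnSn (subset_trans sXR) ?commgSS.
Qed.

(* Each term E i.+1 lies in every term of the lower central series of any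
   group containing E i and E i.+1. *)
Lemma comm_chain_height gT (C : {group gT}) (E : nat -> {group gT}) n :
    (forall i, (i <= n)%N -> E i \subset C) ->
    (forall i, (i < n)%N -> E i.+1 \subset [~: E i.+1, E i]) ->
  fitting_height_le C n -> E n :=: 1.
Proof.
move=> sEC sEE /fitting_height_lnil[m Cn1]; apply/trivgP.
suff sub i j : (i <= j <= n)%N -> E j \subset lnil m i C.
  by have := sub n n; rewrite leqnn Cn1; apply.
elim: i j => [|i IHi] j /andP[leij lejn] /=; first exact: sEC.
case: j leij lejn => // j leij lejn.
apply: sub_lcn (sEE j lejn); apply: IHi; first by rewrite lejn andbT ltnW.
by rewrite -ltnS leij ltnW.
Qed.

End LowerNilpotentSeries.

(** * Actions with [G, A] a p'-group *)

Section GoodPgroup.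

Implicit Type gT : finGroupType.

(* For a p-group A acting on a solvable group G, goodness amounts to [G, A]
   being a p'-group, a condition inherited by subgroups and quotients. *)
Definition pgood (p : nat) gT (A G : {set gT}) :=
  [&& p.-group A, A \subset 'N(G) & p^'.-group [~: G, A]].

Lemma pgoodS (p : nat) gT (A B G H : {group gT}) :
  B \subset A -> H \subset G -> B \subset 'N(H) -> pgood p A G -> pgood p B H.
Proof.
move=> sBA sHG nHB /and3P[pA _ p'R].
by rewrite /pgood (pgroupS sBA) // nHB (pgroupS _ p'R) ?commgSS.
Qed.

Lemma pgood_quotient (p : nat) gT (A G N : {group gT}) :
  A \subset 'N(N) -> G \subset 'N(N) -> pgood p A G -> pgood p (A / N) (G / N).
Proof.
move=> nNA nNG /and3P[pA nGA p'R]; apply/and3P; split.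
- exact: quotient_pgroup.
- exact: quotient_norms.
by rewrite -quotientR ?quotient_pgroup.
Qed.

(** [A] acts trivially on [H / [~: H, A]], and the kernel is a p'-group; so fixed points lift even
    when [p] divides the order of [H]. *)
Lemma pgood_cent_mod (p : nat) gT (A H K : {group gT}) :
    pgood p A H -> solvable H -> K \subset H -> A \subset 'N(K) ->
    H \subset 'N(K) -> [~: H, A] \subset K ->
  H \subset K * 'C_H(A).
Proof.
case/and3P=> pA nHA p'R solH sKH nKA nKH sRK.
have sRH : [~: H, A] \subset H by rewrite commg_subl.
have nRA := commg_normr A H; have nRH := commg_norml H A.
have nRC : 'C_H(A) \subset 'N([~: H, A]) by rewrite (subset_trans (subsetIl _ _)).
apply: subset_trans (mulSg _ sRK); rewrite -quotientK // -sub_quotient_pre //.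
have -> : 'C_H(A) / [~: H, A] = 'C_(H / [~: H, A])(A / [~: H, A]).
  apply: strongest_coprime_quotient_cent => //=.
  - by rewrite subIset // sRH.
  - by rewrite coprime_sym setIid (pnat_coprime pA).
  by rewrite setIid (solvableS sRH).
by rewrite subsetI subxx quotient_cents2r.
Qed.

Lemma pgood_pgroup_cent (p : nat) gT (A P : {group gT}) :
  pgood p A P -> p.-group P -> A \subset 'C(P).
Proof.
case/and3P=> pA nPA p'R pP; rewrite centsC; apply/commG1P/eqP.
have pR : p.-group [~: P, A] by rewrite (pgroupS _ pP) // commg_subl.
by rewrite trivg_card1; apply/eqP; apply: pnat_1 pR _; apply: pgroupS p'R.
Qed.

(** For [q = p], intersect [H] with a Sylow subgroup of [H <*> A] containing [A]. Otherwise
    [[~: H, A]] and a Sylow [q]-subgroup of ['C_H(A)] generate an [A]-invariant p'-group of index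
    prime to [q], where the coprime theorem applies. *)
Lemma pgood_Sylow (p q : nat) gT (A H : {group gT}) :
    prime q -> pgood p A H -> solvable H ->
  exists2 S : {group gT}, q.-Sylow(H) S & A \subset 'N(S).
Proof.
move=> pr_q gAH solH; have [pA nHA p'R] := and3P gAH.
have [-> {q pr_q} | neq_qp] := eqVneq q p.
  have [S sylS sAS] := Sylow_superset (joing_subr H A) pA.
  exists (H :&: S)%G; last by rewrite normsI // (subset_trans sAS) ?normG.
  apply: Sylow_setI_normal sylS.
  by rewrite /normal joing_subl join_subG normG.
set K := [~: H, A]%G; have sKH : K \subset H by rewrite commg_subl.
have nKA : A \subset 'N(K) := commg_normr A H.
have nKH : H \subset 'N(K) := commg_norml H A.
have [Q sylQ] := Sylow_exists q 'C_H(A); have [sQC qQ _] := and3P sylQ.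
have [sQH cQA] := subsetIP sQC.
have nKQ := subset_trans sQH nKH.
have defH : H :=: K * 'C_H(A).
  apply/eqP; rewrite eqEsubset mul_subG ?subsetIl // andbT.
  exact: (pgood_cent_mod gAH).
pose L := (K <*> Q)%G; have defL : L :=: K * Q by rewrite /= norm_joinEr.
have sLH : L \subset H by rewrite join_subG sKH.
have p'L : p^'.-group L.
  rewrite defL pgroupM p'R /=.
  by apply: sub_in_pnat qQ => r _ /eqnP->; rewrite !inE.
have nLA : A \subset 'N(L) by rewrite normsY // cents_norm // centsC.
have coLA : coprime #|L| #|A| by rewrite coprime_sym (pnat_coprime pA).
have [S sylS nSA] := sol_coprime_Sylow_exists q (pgroup_sol pA) nLA coLA.
exists S => //; have [sSL qS q'LS] := and3P sylS.
rewrite /pHall (subset_trans sSL) // qS -(Lagrange_index sLH sSL) pnatM q'LS.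
rewrite andbT; have [_ _ q'CQ] := and3P sylQ; apply: pnat_dvd q'CQ.
have defHL : H :=: L * 'C_H(A).
  apply/eqP; rewrite eqEsubset mul_subG ?subsetIl // andbT.
  by rewrite {1}defH mulSg // joing_subl.
by rewrite [X in #|X : _|]defHL indexMg indexgS // joing_subr.
Qed.

(** Lifting goes from the top down. Choose an [A]-invariant Sylow subgroup [S] of the top group; a
    Frattini argument inside [N * S] shows that [N] and [H i :&: 'N(S)] generate [H i]. The
    induction continues inside ['N(S)], so every lower lift normalises [S]. *)
Lemma pgood_lift (p : nat) k gT (A N : {group gT}) (H : nat -> {group gT}) q :
    (forall i, (i < k)%N ->
      [/\ pgood p A (H i), solvable (H i), N <| H i, prime (q i)
        & (q i).-nat #|H i : N|]) ->
    A \subset 'N(N) ->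
    (forall i j, (i <= j < k)%N -> H i \subset 'N(H j)) ->
  exists2 P : nat -> {group gT},
    forall i, (i < k)%N -> [/\ P i \subset H i, A \subset 'N(P i),
                               (q i).-group (P i) & H i :=: N * P i]
    & forall i j, (i <= j < k)%N -> P i \subset 'N(P j).
Proof.
elim: k => [|k IHk] in N H *; first by exists H => // i j; rewrite ltn0 andbF.
move=> gH nNA nHH; have [gAk solk nsNk pr_qk qk] := gH k (ltnSn k).
have [S sylS nSA] := pgood_Sylow pr_qk gAk solk.
have [sSH qS q'S] := and3P sylS; have [sNHk nNHk] := andP nsNk.
have defHk : H k :=: N * S.
  apply: esym; apply: coprime_index_mulG => //.
  exact: pnat_coprime qk q'S.
have defH i : (i <= k)%N -> H i :=: N * (H i :&: 'N(S)).
  move=> leik; have [_ _ nsNi _ _] := gH i leik.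
  have [sNi nNi] := andP nsNi.
  apply/eqP; rewrite eqEsubset mul_subG ?subsetIl // andbT.
  apply/subsetP=> x Hx.
  have nHkx : x \in 'N(H k) by apply: (subsetP (nHH i k _)); rewrite ?leik /=.
  have sylSx : (q k).-Sylow(H k) (S :^ x) by rewrite -(normP nHkx) pHallJ2.
  have [y Hy defSx] := Sylow_trans sylS sylSx.
  have /mulsgP[n' s' Nn' Ss' defy] : y^-1 \in N * S by rewrite -defHk groupV.
  have Mx : x * n' \in 'N(S).
    apply/normP; rewrite conjsgM defSx -conjsgM.
    have ->: y * n' = s'^-1.
      by apply: (mulgI y^-1); rewrite mulKg defy mulgK.
    by rewrite conjGid ?groupV.
  have Hn' : n' \in H i by apply: (subsetP sNi).
  have Hx' : x * n' \in H i :&: 'N(S) by rewrite inE Mx groupM.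
  rewrite -(normC (subset_trans (subsetIl _ _) nNi)).
  by rewrite -(mulgK n' x) mem_mulg ?groupV.
pose H' i := (H i :&: 'N(S))%G; pose N' := (N :&: 'N(S))%G.
have nNA' : A \subset 'N(N') by rewrite normsI ?norms_norm.
have sNH' i : (i <= k)%N -> N' \subset H' i.
  by move=> leik; have [_ _ /andP[sNi _] _ _] := gH i leik; rewrite setSI.
have gH' i : (i < k)%N ->
    [/\ pgood p A (H' i), solvable (H' i), N' <| H' i, prime (q i)
      & (q i).-nat #|H' i : N'|].
  move=> ltik; have leik := ltnW ltik; have [gi soli nsNi pr_qi qi] := gH i leik.
  have nHA : A \subset 'N(H i) by case/and3P: gi.
  split=> //.
  - by apply: pgoodS gi; rewrite ?subsetIl // normsI ?norms_norm.
  - exact: solvableS (subsetIl _ _) soli.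
  - rewrite /normal sNH' //=; apply: normsI.
      exact: subset_trans (subsetIl _ _) (normal_norm nsNi).
    exact: subset_trans (subsetIr _ _) (normG _).
  have <- : #|H i : N| = #|H' i : N'|; last by [].
  rewrite [in LHS](defH i leik) indexMg -(indexgI (H' i) N).
  congr #|_ : _|; rewrite /= setIAC; congr (_ :&: _).
  by apply/setIidPr; apply: normal_sub.
have nHH' i j : (i <= j < k)%N -> H' i \subset 'N(H' j).
  case/andP=> leij ltjk.
  apply: normsI; last exact: subset_trans (subsetIr _ _) (normG _).
  by apply: subset_trans (subsetIl _ _) (nHH _ _ _); rewrite leij ltnW.
have [P PH nPP] := IHk N' H' gH' nNA' nHH'.
exists (fun i => if (i < k)%N then P i else S).
  move=> i; rewrite ltnS leq_eqVlt => /predU1P[-> | ltik]; first by rewrite ltnn.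
  rewrite ltik; have [sPH nPA qP defH'] := PH i ltik; split=> //.
    exact: subset_trans sPH (subsetIl _ _).
  rewrite [LHS](defH i (ltnW ltik)) [_ :&: _]defH' mulgA.
  by congr (_ * _); apply: mulGSid; apply: subsetIl.
move=> i j /andP[leij]; rewrite ltnS leq_eqVlt => /predU1P[ejk | ltjk].
  rewrite ejk ltnn; case: ifP => [ltik | _]; last exact: normG.
  by have [sPH _ _ _] := PH i ltik; rewrite (subset_trans sPH) ?subsetIr.
by rewrite ltjk (leq_ltn_trans leij ltjk) nPP // leij.
Qed.

End GoodPgroup.

(** * Existence of towers *)

Section Towers.
Implicit Type gT : finGroupType.

(* A tower of height h is alive when [P h, [P h.-1, [..., P 0]]] != 1; towers of
   A-invariant subgroups of this kind witness a large Fitting height. *)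
Fixpoint tower_comm gT (P : nat -> {group gT}) k : {group gT} :=
  if k is k'.+1 then [~: P k'.+1, tower_comm P k']%G else P 0.

Definition tower gT (A : {set gT}) (q : nat -> nat) h (P : nat -> {group gT}) :=
  [/\ forall i, (i <= h)%N ->
        [/\ prime (q i), (q i).-group (P i) & A \subset 'N(P i)],
      forall i j, (i <= j <= h)%N -> P i \subset 'N(P j),
      forall i, (i < h)%N -> q i != q i.+1
    & tower_comm P h :!=: 1].

Lemma eq_tower_comm gT (P Q : nat -> {group gT}) k :
  (forall i, (i <= k)%N -> P i :=: Q i) -> tower_comm P k :=: tower_comm Q k.
Proof.
elim: k => [|k IHk] eqPQ /=; first exact: eqPQ.
by rewrite eqPQ // IHk // => i leik; rewrite eqPQ // leqW.
Qed.

Lemma tower_comm_sub gT (P : nat -> {group gT}) h k :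
    (forall i j, (i <= j <= h)%N -> P i \subset 'N(P j)) -> (k <= h)%N ->
  tower_comm P k \subset P k.
Proof.
move=> nPP; elim: k => //= k IHk ltkh.
rewrite commg_subl (subset_trans (IHk (ltnW ltkh))) //.
by rewrite nPP // leqnSn.
Qed.

Lemma tower_comm_norm gT (P : nat -> {group gT}) h k (B : {group gT}) :
    (forall i, (i <= h)%N -> B \subset 'N(P i)) -> (k <= h)%N ->
  B \subset 'N(tower_comm P k).
Proof.
move=> nPB; elim: k => [|k IHk] lekh /=; first exact: nPB.
by rewrite normsR ?nPB ?IHk // ltnW.
Qed.

Lemma tower_comm_quotient gT (P : nat -> {group gT}) h k (N : {group gT})
    (R : nat -> {group coset_of N}) :
    (forall i, (i <= h)%N -> P i \subset 'N(N) /\ P i / N = R i) ->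
    (forall i j, (i <= j <= h)%N -> P i \subset 'N(P j)) ->
    (k <= h)%N ->
  tower_comm P k / N = tower_comm R k.
Proof.
move=> PR nPP; elim: k => [|k IHk] lekh /=; first by case: (PR 0).
have [nNP <-] := PR k.+1 lekh.
rewrite quotientR ?IHk //; first exact: ltnW.
have [nNPk _] := PR k (ltnW lekh).
by rewrite (subset_trans _ nNPk) // (tower_comm_sub nPP) // ltnW.
Qed.

(** A tower of [G / 'F(G)] is lifted by [pgood_lift] and some ['O_r(G)] is put on top. The clause on
    [P h] serves the induction: it confines the lifted commutator to the preimage of one primary
    part of the Fitting subgroup of [G / 'F(G)]. *)
Lemma exists_tower p h gT (A G : {group gT}) :
    pgood p A G -> solvable G -> ~ fitting_height_le G h ->
  exists q P, [/\ tower A q h P, forall i, (i <= h)%N -> P i \subset G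
                & P h :=: 'O_(q h)(G)].
Proof.
elim: h => [|h IHh] in gT A G * => gA solG nhG.
  have ntG : G :!=: 1.
    by apply/eqP=> G1; case: nhG; exists (fun _ => 1%G); rewrite G1.
  have ntF : 'F(G) != 1.
    apply: contra ntG => /eqP F1.
    by have := solvable_cent_Fitting solG; rewrite F1 cent1T setIT subG1.
  have [q qF ntQ] : exists2 q, prime q & 'O_q(G) != 1.
    exists (pdiv #|'F(G)|); first by rewrite pdiv_prime // cardG_gt1.
    rewrite -p_core_Fitting -cardG_gt1.
    rewrite (card_Hall (nilpotent_pcore_Hall _ (Fitting_nil G))).
    by rewrite p_part_gt1 pi_pdiv cardG_gt1.
  exists (fun=> q), (fun=> 'O_q(G)%G); split=> //; last by move=> *; apply: pcore_sub.
  split=> //= i _.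
  split=> //; first exact: pcore_pgroup.
  by have /and3P[_ nGA _] := gA; rewrite gFnorm_trans.
pose F := 'F(G)%G.
have nsFG : F <| G := Fitting_normal G.
have [pA nGA p'R] := and3P gA; have nFG := normal_norm nsFG.
have nFA : A \subset 'N(F) by rewrite gFnorm_trans.
have gAF : pgood p (A / F) (G / F) by apply: pgood_quotient.
have nhGF : ~ fitting_height_le (G / F) h.
  move/fitting_height_lnil=> [m Gm]; case: nhG; apply/fitting_height_lnil.
  have sLF : lnil m h G \subset F.
    have sLG := char_sub (lnil_char m h G).
    rewrite -quotient_sub1 ?(subset_trans sLG) // [_ / _](lnil_morphim _ _ _ nFG).
    by have -> : lnil m h (G / F) :=: 1 by rewrite Gm.
  have [m' Fm'] := lcnP _ (Fitting_nil G).
  (* One class bound must serve both the quotient and [F], hence the maximum. *)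
  exists (maxn m m'); apply/trivGP => /=.
  apply: subset_trans (lcnS _ (subset_trans _ sLF)) _ => /=; last first.
    by rewrite -Fm' lcn_sub_leq // ltnS leq_maxr.
  elim: (h) => //= k IHk; apply: subset_trans (lcn_sub_leq _ _) (lcnS _ IHk).
  by rewrite ltnS leq_maxl.
have [q [P [[Pq nPP neq_q ntP] sPG defPh]]] := IHh _ _ _ gAF (quotient_sol _ solG) nhGF.
pose H i := (coset F @*^-1 P i)%G.
have sFH i : F \subset H i by apply: sub_cosetpre.
have HP i : H i / F = P i by apply: cosetpreK.
have sHG i : (i <= h)%N -> H i \subset G.
  by move=> leih; rewrite sub_cosetpre_quo ?sPG.
have nHP i (B : {group gT}) :
    B \subset 'N(F) -> B / F \subset 'N(P i) -> B \subset 'N(H i).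
  move=> nFB nPB; rewrite -HP in nPB.
  have nsFH : F <| H i by rewrite /normal sFH subsetIl.
  rewrite -(quotientSGK nFB) ?quotient_normG //.
  exact: subset_trans (sFH i) (normG _).
have [||| R RH nRR] := @pgood_lift p h.+1 _ A F H q.
- move=> i; rewrite ltnS => leih; have [pr_qi qPi nPA] := Pq i leih.
  have nHA : A \subset 'N(H i) by rewrite nHP //; case: (Pq i leih).
  split=> //.
  + exact: pgoodS (subxx A) (sHG i leih) nHA gA.
  + by rewrite (solvableS (sHG i leih)).
  + by rewrite /normal sFH (subset_trans (sHG i leih)).
  by rewrite -card_quotient ?HP // (subset_trans (sHG i leih)).
- by [].
- move=> i j /andP[leij]; rewrite ltnS => lejh.
  rewrite nHP ?(subset_trans (sHG _ _)) ?(leq_trans leij) //.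
  by rewrite HP nPP // leij.
have RP i : (i <= h)%N -> R i \subset 'N(F) /\ R i / F = P i.
  move=> leih; have [sRH _ _ defH] := RH i leih.
  have nFR: R i \subset 'N(F) by rewrite (subset_trans sRH) ?(subset_trans (sHG i leih)).
  by split=> //; rewrite -HP defH quotientMidl.
have nRR' i j : (i <= j <= h)%N -> R i \subset 'N(R j) by apply: nRR.
set D := tower_comm R h.
have DF : D / F = tower_comm P h by apply: tower_comm_quotient RP nRR' _.
have sDR : D \subset R h := tower_comm_sub nRR' (leqnn h).
(* With [s = q h], suppose [D] centralises the s'-part of [F]; then it lies in [K]. But [K] is the
   product of a nilpotent s'-group and an [s]-group centralising it, so it is nilpotent and normal,
   hence in [F], and the tower of [G / F] would be dead. So [D] moves a Sylow [r]-subgroup of the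
   s'-part of [F]. *)
have [r [pr_r neq_rq ncD]] :
  exists r, [/\ prime r, r != q h & ~~ (D \subset 'C('O_r(G)))].
  set s := q h; pose M := (coset F @*^-1 'O_s(G / F))%G.
  have pr_s : prime s by case: (Pq h (leqnn h)).
  pose K := ('C_M('O_s^'(F)))%G.
  have nsMG : M <| G by rewrite -(quotientGK nsFG) cosetpre_normal pcore_normal.
  have nsKG : K <| G.
    apply/andP; split; first exact: subset_trans (subsetIl _ _) (normal_sub nsMG).
    apply: normsI; first exact: normal_norm.
    by rewrite norms_cent // !gFnorm_trans ?normG.
  have sDM : D \subset M.
    have nFD : D \subset 'N(F) by rewrite (subset_trans sDR) ?(proj1 (RP h _)).
    rewrite -sub_quotient_pre // DF /=.
    have defPs : P h :=: 'O_s(G / F) := defPh.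
    by rewrite -defPs; apply: tower_comm_sub nPP _.
  have ncK : ~~ (D \subset K).
    apply: contra ntP => sDK; rewrite -subG1 -DF quotient_sub1.
      apply: subset_trans sDK (Fitting_max nsKG _).
      pose KF := (K :&: F)%G; pose Z := 'O_s^'(KF)%G.
      have nilKF : nilpotent KF by apply: nilpotentS (subsetIr _ _) (Fitting_nil G).
      have [T sylT] := Sylow_exists s K; have [sTK sT s'KT] := and3P sylT.
      have sZKF : Z \subset KF := pcore_sub _ _.
      have sKFK : KF \subset K := subsetIl _ _.
      have nFK : K \subset 'N(F) := subset_trans (normal_sub nsKG) nFG.
      have sKZ : s.-nat #|K : Z|.
        rewrite -(Lagrange_index sKFK sZKF) pnatM; apply/andP; split.
          rewrite indexgI -card_quotient //; apply: pgroupS (pcore_pgroup s (G / F)).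
          by rewrite sub_quotient_pre // subsetIl.
        by have /and3P[_ _] := nilpotent_pcore_Hall s^' nilKF; rewrite pnatNK.
      have defK : Z * T = K.
        apply: coprime_index_mulG => //; first exact: subset_trans sZKF sKFK.
        exact: pnat_coprime sKZ s'KT.
      rewrite -defK mulg_nil ?(nilpotentS sZKF) ?(pgroup_nil sT) //.
      rewrite (subset_trans sTK) // (subset_trans (subsetIr _ _)) // centS //.
      have hallF := nilpotent_pcore_Hall s^' (Fitting_nil G).
      rewrite (sub_normal_Hall hallF) ?pcore_pgroup ?pcore_normal //.
      exact: subset_trans sZKF (subsetIr _ _).
    by rewrite (subset_trans sDR) ?(proj1 (RP h _)).
  have {ncK}: ~~ ('O_s^'(F) \subset 'C(D)).
    by apply: contra ncK => cD; rewrite subsetI sDM centsC.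
  rewrite -{1}(Sylow_gen 'O_s^'(F)) gen_subG => /bigcupsP ncD.
  have [S /andP[/SylowP[r pr_r sylS] ncS]] :
      exists S : {group gT}, Sylow 'O_s^'(F) S && ~~ (S \subset 'C(D)).
    apply/existsP; apply: contraT => /existsPn allS; case: ncD => S sylS.
    by have := allS S; rewrite sylS negbK.
  have [sSO rS _] := and3P sylS.
  exists r; split=> //.
    apply: contra ncS => /eqP ers.
    have /eqP : #|S| = 1%N.
      apply: (pnat_1 rS); rewrite ers.
      exact: pgroupS sSO (pcore_pgroup _ _).
    by rewrite -trivg_card1 => /eqP->; apply: sub1G.
  apply: contra ncS; rewrite centsC; apply: subset_trans.
  rewrite -p_core_Fitting.
  rewrite (sub_normal_Hall (nilpotent_pcore_Hall r (Fitting_nil G))) ?pcore_normal //.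
  exact: subset_trans sSO (pcore_sub _ _).
pose q' i := if (i <= h)%N then q i else r.
pose R' i := if (i <= h)%N then R i else 'O_r(G)%G.
exists q', R'.
have R'E i : (i <= h)%N -> R' i = R i by rewrite /R' => ->.
have q'E i : (i <= h)%N -> q' i = q i by rewrite /q' => ->.
have R'r : R' h.+1 = 'O_r(G)%G by rewrite /R' ltnn.
have q'r : q' h.+1 = r by rewrite /q' ltnn.
split; last by rewrite R'r q'r.
  split=> [i | i j /andP[leij] | i | ].
  - rewrite leq_eqVlt ltnS => /predU1P[-> | leih].
      by rewrite R'r q'r pr_r pcore_pgroup gFnorm_trans.
    have [pr_qi _ _] := Pq i leih; have [_ nRA qR _] := RH i leih.
    by rewrite R'E ?q'E.
  - rewrite leq_eqVlt ltnS => /predU1P[ej | lejh].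
      rewrite ej R'r; move: leij; rewrite ej leq_eqVlt ltnS => /predU1P[-> | leih].
        by rewrite R'r normG.
      rewrite R'E // gFnorm_trans //; have [sRH _ _ _] := RH i leih.
      by rewrite (subset_trans sRH) ?(subset_trans (sHG i leih)) ?normG.
    by rewrite !R'E ?(leq_trans leij) // nRR' // leij.
  - rewrite ltnS leq_eqVlt => /predU1P[-> | ltih].
      by rewrite q'r q'E // eq_sym.
    by rewrite !q'E ?neq_q // ltnW.
  rewrite /= R'r (@eq_tower_comm _ R' R h) => [|i leih]; last by rewrite R'E.
  by apply: contra ncD => /eqP/commG1P; rewrite centsC.
move=> i; rewrite leq_eqVlt ltnS => /predU1P[-> | leih].
  by rewrite R'r pcore_sub.
by have [sRH _ _ _] := RH i leih; rewrite R'E // (subset_trans sRH) ?sHG.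
Qed.
End Towers.

(** * Minimal towers *)

Section MinimalTower.

Variables (gT : finGroupType) (p : nat) (A : {group gT}).
Variables (q : nat -> nat) (h : nat) (P : nat -> {group gT}).

Fixpoint tower_act k : {group gT} :=
  if k is k'.+1 then (tower_act k' <*> P k')%G else A.

(* [tower_kerr j] is the subgroup of P (h - j) acting trivially on
   P (h - j + 1) modulo [tower_kerr (j - 1)]. *)
Fixpoint tower_kerr j : {group gT} :=
  if j is j'.+1 then modcent_group (P (h - j)) (P (h - j')) (tower_kerr j')
  else 1%G.
Definition tower_ker k := tower_kerr (h - k).

(* In a minimal tower, [tower_max k] contains every proper subgroup of P k that
   is invariant under A and all the lower P i: see [tower_maxP]. *)
Definition tower_max k : {group gT} :=
  if k is k'.+1 then modcent_group (P k) (P k') (tower_ker k) else tower_ker 0.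

Local Notation X := tower_act.
Local Notation T := tower_ker.
Local Notation M := tower_max.

Hypotheses (pr_p : prime p) (abA : p.-abelem A).
Hypothesis towP : tower A q h P.
(** The second alternative is for levels that are [p]-groups, which [A] centralises by
    [pgood_pgroup_cent]. *)
Hypothesis coPA : forall i, (i <= h)%N -> coprime #|P i| #|A| || (A \subset 'C(P i)).
Hypothesis minP : forall Q : nat -> {group gT}, (forall i, (i <= h)%N -> Q i \subset P i) ->
  tower A q h Q -> forall i, (i <= h)%N -> Q i :=: P i.

Let pr_q i : (i <= h)%N -> prime (q i).
Proof. by case: towP => Pq _ _ _ /Pq[]. Qed.
Let qP i : (i <= h)%N -> (q i).-group (P i).
Proof. by case: towP => Pq _ _ _ /Pq[]. Qed.
Let nPA i : (i <= h)%N -> A \subset 'N(P i).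
Proof. by case: towP => Pq _ _ _ /Pq[]. Qed.
Let nPP i j : (i <= j)%N -> (j <= h)%N -> P i \subset 'N(P j).
Proof. by case: towP => _ nPP _ _ leij lejh; apply: nPP; rewrite leij. Qed.
Let solP i : (i <= h)%N -> solvable (P i).
Proof. by move=> leih; apply: pgroup_sol (qP leih). Qed.
Lemma tower_coprime i : (i < h)%N -> coprime #|P i.+1| #|P i|.
Proof.
move=> ltih; rewrite coprime_sym (pnat_coprime (qP (ltnW ltih))) //.
apply: sub_in_pnat (qP ltih) => r _ /eqnP->; rewrite !inE eq_sym.
by case: towP => _ _ /(_ i ltih).
Qed.
Let coPP := tower_coprime.

Lemma tower_ker_last : T h = 1%G.
Proof. by rewrite /T subnn. Qed.

Lemma tower_kerE k :
  (k < h)%N -> T k = modcent_group (P k) (P k.+1) (T k.+1).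
Proof.
move=> ltkh; rewrite /T; have -> : (h - k = (h - k.+1).+1)%N by rewrite subnSK.
by rewrite /= -/(tower_kerr _) subnSK // !subKn // ltnW.
Qed.

Lemma tower_ker_sub k : (k <= h)%N -> T k \subset P k.
Proof.
rewrite leq_eqVlt => /predU1P[-> | ltkh]; first by rewrite tower_ker_last sub1G.
by rewrite tower_kerE // modcent_sub.
Qed.

Lemma tower_ker_norm k (B : {group gT}) : (k <= h)%N ->
  (forall i, (k <= i <= h)%N -> B \subset 'N(P i)) -> B \subset 'N(T k).
Proof.
move=> lekh; rewrite -(subKn lekh); move: (h - k)%N (leq_subr k h) => j.
elim: j => [|j IHj] in B *.
  by rewrite subn0 tower_ker_last norms1.
move=> ltjh nPB; have lth : (h - j.+1 < h)%N by rewrite ltn_subrL (leq_ltn_trans _ ltjh).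
have ej : ((h - j.+1).+1 = h - j)%N by rewrite subnSK.
have lej := leq_subr j h.
rewrite tower_kerE //= ej; apply: modcent_norm; first 1 last.
- by apply: IHj (ltnW ltjh) _ => i /andP[lei leih]; apply: nPP.
- by apply: nPB; rewrite leqnn ltnW.
- by apply: nPB; rewrite lej -ej leqnSn.
- apply: IHj (ltnW ltjh) _ => i /andP[lei leih]; apply: nPB; rewrite leih andbT.
  by rewrite (leq_trans _ lei) // -ej.
apply: IHj (ltnW ltjh) _ => i /andP[lei leih]; apply: nPP => //.
by rewrite (leq_trans _ lei) // -ej.
Qed.

Lemma tower_ker_normP i k : (i <= k)%N -> (k <= h)%N -> P i \subset 'N(T k).
Proof.
move=> leik lekh; apply: tower_ker_norm => // j /andP[lekj lejh].
by rewrite nPP // (leq_trans leik).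
Qed.

Lemma tower_act_normP k i : (k <= i <= h)%N -> X k \subset 'N(P i).
Proof.
case/andP=> leki leih; elim: k leki => [|k IHk] ltki /=; first exact: nPA.
by rewrite join_subG IHk ?nPP // ltnW.
Qed.

Lemma tower_act_normT k i : (k <= i <= h)%N -> X k \subset 'N(T i).
Proof.
case/andP=> leki leih; apply: tower_ker_norm => // j /andP[leij lejh].
by rewrite tower_act_normP // (leq_trans leki).
Qed.

Lemma sub_tower_ker k (S : {set gT}) : (k < h)%N -> S \subset P k ->
  (S \subset T k) = ([~: S, P k.+1] \subset T k.+1).
Proof.
by move=> ltkh sSP; rewrite tower_kerE // sub_modcent ?tower_ker_normP // leqnSn.
Qed.

Lemma tower_act_A k : A \subset X k.
Proof. by elim: k => //= k IHk; rewrite (subset_trans IHk) ?joing_subl. Qed.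

Lemma tower_act_P i k : (i < k)%N -> P i \subset X k.
Proof.
elim: k => // k IHk; rewrite ltnS leq_eqVlt => /predU1P[-> | /IHk sPX] /=.
  exact: joing_subr.
by rewrite (subset_trans sPX) ?joing_subl.
Qed.

(** By [sub_tower_ker], taking the commutator with the next level trades [T i] for [T i.+1], and
    [T h] is trivial. So [T k] is exactly the part of level [k] that dies on the way up. *)
Lemma tower_comm_alive (Q : nat -> {group gT}) k :
    (k <= h)%N -> (forall i j, (i <= j <= h)%N -> Q i \subset 'N(Q j)) ->
    (Q k \subset P k) -> (forall i, (k < i <= h)%N -> Q i = P i) ->
  (tower_comm Q k \subset T k) = (tower_comm Q h :==: 1).
Proof.
move=> lekh nQQ sQP eQP; rewrite -subG1 -[1]/(gval 1%G) -tower_ker_last.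
have {sQP}sDP i : (k <= i <= h)%N -> tower_comm Q i \subset P i.
  case/andP=> leki leih; apply: subset_trans (tower_comm_sub nQQ leih) _.
  move: leki; rewrite leq_eqVlt => /predU1P[<- // | ltki].
  by rewrite eQP ?ltki.
have step i : (k <= i < h)%N ->
   (tower_comm Q i \subset T i) = (tower_comm Q i.+1 \subset T i.+1).
  case/andP=> leki ltih; have sDPi : tower_comm Q i \subset P i.
    by rewrite sDP // leki ltnW.
  rewrite (sub_tower_ker ltih sDPi) /= eQP; first by rewrite commGC.
  by rewrite ltnS leki.
suff gen d : (k + d <= h)%N ->
   (tower_comm Q k \subset T k) = (tower_comm Q (k + d) \subset T (k + d)).
  by rewrite (gen (h - k)%N) subnKC.
elim: d => [|d IHd] lekdh; first by rewrite addn0.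
by rewrite addnS in lekdh *; rewrite -step ?leq_addr // IHd // ltnW.
Qed.

Let nPP' i j : (i <= j <= h)%N -> P i \subset 'N(P j).
Proof. by case/andP; apply: nPP. Qed.

(** The iterated commutators form a tower inside [P]: by coprime action, iterating them again
    changes nothing, so this tower is alive, and minimality applies. *)
Lemma tower_comm_min i : (i <= h)%N -> tower_comm P i :=: P i.
Proof.
pose D := tower_comm P; have sDP j : (j <= h)%N -> D j \subset P j.
  exact: tower_comm_sub nPP'.
have nDA j : (j <= h)%N -> A \subset 'N(D j).
  by apply: tower_comm_norm => k; apply: nPA.
have nDP k j : (k <= j)%N -> (j <= h)%N -> P k \subset 'N(D j).
  elim: j => [|j IHj]; rewrite ?leqn0 => lekj lejh.
    by rewrite (eqP lekj) normG.
  move: lekj; rewrite leq_eqVlt => /predU1P[-> | ltkj]; first exact: commg_norml.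
  by rewrite normsR ?nPP ?IHj // ltnW.
have eqD j : (j <= h)%N -> tower_comm D j :=: D j.
  elim: j => //= j IHj ltjh; rewrite IHj ?(ltnW ltjh) //.
  have sDPj := sDP j (ltnW ltjh).
  rewrite coprime_commGid ?solP ?(coprimegS sDPj) ?coPP //.
  by rewrite (subset_trans sDPj) ?nPP.
apply: minP => //; have [Pq _ neq_q ntP] := towP; split=> //.
- move=> j lejh; have [pr_qj qPj _] := Pq j lejh.
  by split; rewrite ?nDA ?(pgroupS (sDP j lejh)).
- move=> k j /andP[lekj lejh]; rewrite (subset_trans (sDP k _)) ?nDP //.
  exact: leq_trans lejh.
by rewrite eqD.
Qed.

Lemma tower_commE k : (k < h)%N -> [~: P k.+1, P k] = P k.+1.
Proof.
by move=> ltkh; have /= := tower_comm_min ltkh; rewrite tower_comm_min 1?ltnW.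
Qed.

Lemma tower_not_ker k : (k <= h)%N -> ~~ (P k \subset T k).
Proof.
move=> lekh; rewrite -(tower_comm_min lekh) (tower_comm_alive lekh) //.
by case: towP.
Qed.

Lemma tower_max_sub k : (k <= h)%N -> M k \subset P k.
Proof. by case: k => [|k] lekh /=; rewrite ?tower_ker_sub ?modcent_sub. Qed.

Lemma sub_tower_max k (S : {set gT}) : (k < h)%N -> S \subset P k.+1 ->
  (S \subset M k.+1) = ([~: S, P k] \subset T k.+1).
Proof. by move=> ltkh sSP; rewrite sub_modcent ?tower_ker_normP. Qed.

Lemma tower_act_normM k : (k <= h)%N -> X k \subset 'N(M k).
Proof.
case: k => [|k] ltkh; first by rewrite tower_act_normT ?leqnn.
have lekh := ltnW ltkh; apply: modcent_norm.
- exact: tower_ker_normP.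
- by rewrite tower_ker_normP.
- by rewrite tower_act_normP // leqnn.
- by rewrite /= join_subG normG andbT tower_act_normP // leqnn.
by rewrite tower_act_normT // leqnn.
Qed.

Lemma tower_ker_max k : (k <= h)%N -> T k \subset M k.
Proof.
case: k => //= k lekh; rewrite sub_modcent ?tower_ker_normP ?tower_ker_sub //.
by rewrite commGC commg_subr tower_ker_normP.
Qed.

Lemma tower_not_max k : (k <= h)%N -> ~~ (P k \subset M k).
Proof.
case: k => [|k] lekh; first exact: tower_not_ker.
by rewrite sub_tower_max // tower_commE // tower_not_ker.
Qed.

(** Putting [Q] in place of level [k] preserves all of [tower] but survival, so by minimality the
    new sequence is dead; [tower_comm_alive] locates this death at level [k]. *)
Lemma tower_maxP k (Q : {group gT}) :
    (k <= h)%N -> Q \subset P k -> X k \subset 'N(Q) -> Q :!=: P k ->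
  Q \subset M k.
Proof.
move=> lekh sQP nQX neqQP; pose R i := if i == k then Q else P i.
have Rk : R k = Q by rewrite /R eqxx.
have RP i : i != k -> R i = P i by rewrite /R => /negPf->.
have sRP i : (i <= h)%N -> R i \subset P i.
  by move=> leih; have [-> | neq] := eqVneq i k; rewrite ?Rk ?RP.
have nRR i j : (i <= j <= h)%N -> R i \subset 'N(R j).
  case/andP=> leij lejh; have [ejk | neqjk] := eqVneq j k; last first.
    by rewrite (RP j) // (subset_trans (sRP i (leq_trans leij lejh))) ?nPP.
  rewrite ejk Rk; have [-> | neqik] := eqVneq i k; first by rewrite Rk normG.
  rewrite RP // (subset_trans (tower_act_P _) nQX) // ltn_neqAle neqik.
  by rewrite -ejk.
have dead : tower_comm R h :==: 1.
  apply: contraR neqQP => alive; have [Pq _ neq_q _] := towP.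
  have towR : tower A q h R.
    split=> // i leih; have [pr_qi qPi nPAi] := Pq i leih.
    split; rewrite ?(pgroupS (sRP i leih)) //.
    have [-> | neq] := eqVneq i k; last by rewrite RP.
    by rewrite Rk (subset_trans (tower_act_A k)).
  by rewrite -Rk (minP sRP towR).
have := tower_comm_alive lekh nRR; rewrite Rk => /(_ sQP).
rewrite dead => alive.
have {}alive : tower_comm R k \subset T k.
  by rewrite alive // => i /andP[ltki _]; rewrite RP // gtn_eqF.
case: k => [|k] in lekh sQP nQX neqQP R Rk RP sRP nRR dead alive *.
  by rewrite /= Rk in alive.
rewrite sub_tower_max //; move: alive => /=; rewrite Rk.
rewrite (@eq_tower_comm _ R P k) ?tower_comm_min ?(ltnW lekh) // => i leik.
by rewrite RP // ltn_eqF.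
Qed.

Lemma tower_der_sub k : (k <= h)%N -> (P k)^`(1) \subset M k.
Proof.
move=> lekh; apply: tower_maxP => //.
- exact: der_sub.
- by rewrite gFnorm_trans // tower_act_normP ?leqnn.
apply/eqP=> /= e; have ntP : P k :!=: 1.
  by apply: contra (tower_not_ker lekh) => /eqP->; apply: sub1G.
by have := sol_der1_proper (solP lekh) (subxx _) ntP; rewrite e properxx.
Qed.

Lemma tower_max_normal k : (k <= h)%N -> M k <| P k.
Proof.
move=> lekh; rewrite /normal tower_max_sub //.
by rewrite sub_der1_norm ?tower_der_sub ?tower_max_sub.
Qed.

(** Level [k] is its own commutator with the level below, which centralises [M k] modulo [T k]; the
    three subgroups lemma concludes. With [tower_der_sub], levels have class at most 2 modulo their
    kernels. *)
Lemma tower_comm_max k : (k <= h)%N -> [~: P k, M k] \subset T k.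
Proof.
case: k => [|k] lekh.
  by rewrite commg_subr /= tower_ker_normP.
have lekh' := ltnW lekh; have sMP := tower_max_sub lekh.
have nTP : P k.+1 \subset 'N(T k.+1) by rewrite tower_ker_normP.
have nTP' : P k \subset 'N(T k.+1) by rewrite tower_ker_normP.
have MP : [~: M k.+1, P k] \subset T k.+1 by rewrite -sub_tower_max.
rewrite -{1}(tower_commE lekh).
apply: (three_subgroup_mod (G := P k) (H := M k.+1)) => //.
- exact: subset_trans sMP nTP.
- rewrite [[~: P k, _]]commGC (subset_trans (commSg _ MP)) //.
  by rewrite commg_subl.
by apply: subset_trans MP; rewrite commSg // commg_subl normal_norm ?tower_max_normal.
Qed.

Lemma tower_gen_max k (J : {group gT}) :
    (0 < k <= h)%N -> J \subset P k -> P k \subset J <*> M k ->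
  P k \subset J <*> T k.
Proof.
case: k => // k lekh sJP sPJM; have lekh' := ltnW lekh.
have pP := qP lekh; have sTP := tower_ker_sub lekh.
have sMP : M k.+1 \subset P k.+1 := tower_max_sub lekh.
set F := ('Phi(P k.+1) <*> T k.+1)%G.
have nTP : P k.+1 \subset 'N(T k.+1) by rewrite tower_ker_normP.
have nFP : P k.+1 \subset 'N(F) by rewrite normsY ?gFnorm.
have nFP' : P k \subset 'N(F).
  by rewrite normsY ?tower_ker_normP // gFnorm_trans ?nPP.
have sFP : F \subset P k.+1 by rewrite join_subG Phi_sub.
have sMF : M k.+1 \subset F.
  rewrite -quotient_sub1 ?(subset_trans sMP) //.
  have abU : abelian (P k.+1 / F).
    rewrite sub_der1_abelian // (subset_trans _ (joing_subl _ _)) //.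
    by rewrite (Phi_joing pP) joing_subl.
  have <- : 'C_[~: P k.+1 / F, P k / F](P k / F) = 1.
    apply: (coprime_abel_cent_TI (A := (P k / F)%G) (G := (P k.+1 / F)%G)) => //.
      by rewrite quotient_norms ?nPP.
    by rewrite coprime_morphl ?coprime_morphr ?coPP.
  rewrite -quotientR // tower_commE // subsetI quotientS //=.
  rewrite quotient_cents2r // (subset_trans _ (joing_subr _ _)) //.
  by rewrite -sub_tower_max.
suff defP : <<J :|: T k.+1>> = P k.+1 by rewrite joingE defP.
apply: Phi_nongen.
apply/eqP; rewrite eqEsubset !join_subG Phi_sub /= subUset sJP sTP /=.
apply: subset_trans sPJM _; rewrite join_subG; apply/andP; split.
  by rewrite sub_gen // subsetU // subsetUl orbT.
by apply: subset_trans sMF _; rewrite genS // setUS // subsetUr.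
Qed.

Lemma tower_descend k (B : {group gT}) :
    (k < h)%N -> B \subset 'N(P k) -> B \subset 'N(P k.+1) ->
    B \subset 'N(T k.+1) ->
  [~: P k.+1, B] \subset T k.+1 -> [~: P k, B] \subset T k.
Proof.
move=> ltkh nPB nPB' nTB sRT.
have nTP : P k.+1 \subset 'N(T k.+1) by rewrite tower_ker_normP.
have nTP' : P k \subset 'N(T k.+1) by rewrite tower_ker_normP.
rewrite sub_tower_ker // ?commg_subl //.
apply: (three_subgroup_mod (G := B) (H := P k.+1)) => //; last first.
  by rewrite (subset_trans _ sRT) // commSg // commg_subl nPP.
rewrite (subset_trans (commSg _ (_ : _ \subset T k.+1))) //; first by rewrite commGC.
by rewrite commg_subl.
Qed.

Let coAP i (B : {group gT}) : (i <= h)%N -> B \subset A ->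
  coprime #|P i| #|B| || (B \subset 'C(P i)).
Proof.
move=> leih sBA; case/orP: (coPA leih) => [co | cA]; apply/orP; [left | right].
  exact: coprimegS co.
exact: subset_trans cA.
Qed.

(** Otherwise ['C_(P k)(B)] would be proper and [X k]-invariant, hence in [M k] together with
    [[~: P k, B]], and the product of the two is [P k]. *)
Lemma tower_cent_full k (B : {group gT}) :
    (k <= h)%N -> B \subset A -> B \subset 'C(X k) -> [~: P k, B] \subset T k ->
  B \subset 'C(P k).
Proof.
move=> lekh sBA cBX sRT; rewrite centsC.
have nPB : B \subset 'N(P k) := subset_trans sBA (nPA lekh).
suff: 'C_(P k)(B) == P k by move/eqP/setIidPl.
apply: contraR (tower_not_max lekh) => neqC.
have sCM : 'C_(P k)(B) \subset M k.
  apply: tower_maxP => //; first exact: subsetIl.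
  apply: normsI; first by rewrite tower_act_normP ?leqnn.
  by rewrite (subset_trans _ (normG _)) // centsC.
case/orP: (coAP lekh sBA) => [co | cB]; last first.
  by move: neqC; rewrite eqEsubset subsetIl subsetIidl centsC cB.
rewrite -(coprime_cent_prod nPB co (solP lekh)) mul_subG //.
exact: subset_trans sRT (tower_ker_max lekh).
Qed.

Lemma tower_cent k (B : {group gT}) :
    (k <= h)%N -> B \subset A -> [~: P k, B] \subset T k ->
  B \subset 'C(X k.+1).
Proof.
move=> lekh sBA; elim: k lekh => [|k IHk] lekh sRT.
  have cBA : B \subset 'C(A).
    by rewrite (subset_trans sBA) // -abelianE (abelem_abelian abA).
  by rewrite /= centY subsetI cBA tower_cent_full.
have cBX : B \subset 'C(X k.+1).
  apply: IHk (ltnW lekh) _; apply: tower_descend sRT => //.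
  - by rewrite (subset_trans sBA) ?nPA // ltnW.
  - by rewrite (subset_trans sBA) ?nPA.
  by rewrite (subset_trans sBA) // (subset_trans (tower_act_A 0)) ?tower_act_normT.
by rewrite centY subsetI cBX tower_cent_full.
Qed.

(** A complement to ['C_B(P k)] of order above [p] would contain independent [a] and [b]. Fixed
    points of its nontrivial elements are proper and [X k]-invariant, so lie in [M k], and
    [rank2_gen_cent] would put all of [P k] there. *)
Lemma tower_cent_card k (B : {group gT}) :
    (k <= h)%N -> B \subset A -> B \subset 'C(X k) ->
  (#|B| <= p * #|'C_B(P k)|)%N.
Proof.
move=> lekh sBA cBX; have abB : p.-abelem B := abelemS sBA abA.
have [D defB] := abelem_split_dprod abB (subsetIl B 'C(P k)).
rewrite -(dprod_card defB) mulnC leq_mul2r; apply/orP; right.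
rewrite leqNgt; apply/negP=> ltpD.
have [_ _ _ tiCD] := dprodP defB; have sDB : D \subset B.
  by case/dprodP: defB => _ <- _ _; apply: mulG_subr.
have abD := abelemS sDB abB.
have /trivgPn[a Da nta] : D :!=: 1 by rewrite -cardG_gt1 (leq_trans _ ltpD) ?ltnS ?prime_gt0.
have /subsetPn[b Db nab] : ~~ (D \subset <[a]>).
  apply: contraL ltpD => /subset_leq_card; rewrite -leqNgt => /leq_trans-> //.
  by rewrite -orderE (abelem_order_p abD).
have nPc c : c \in D -> c \in 'N(P k).
  by move=> Dc; rewrite (subsetP (nPA lekh)) // (subsetP sBA) // (subsetP sDB).
have cM c : c \in D -> c != 1 -> 'C_(P k)[c] \subset M k.
  move=> Dc ntc; have Bc := subsetP sDB c Dc.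
  have cXc : X k \subset 'C[c] by rewrite sub_cent1 (subsetP cBX).
  apply: tower_maxP => //; first exact: subsetIl.
    by rewrite normsI ?tower_act_normP ?leqnn // (subset_trans cXc) ?normG.
  apply: contraNneq ntc => /setIidPl; rewrite sub_cent1 => cPc.
  by rewrite -in_set1 -set1gE -tiCD !inE Bc cPc.
case/orP: (coAP lekh (subset_trans sDB sBA)) => [co | cD]; last first.
  have : a \in [1 gT] by rewrite -tiCD !inE (subsetP sDB) // Da (subsetP cD).
  by rewrite inE (negPf nta).
have [pD cDD eD] := and3P abD.
case/negP: (tower_not_max lekh).
have Dp c : c \in D -> c ^+ p = 1 by move=> Dc; have [_ ->] := abelemP pr_p abD.
apply: (@rank2_gen_cent _ _ _ a b p) => //; rewrite ?nPc ?Dp ?cM ?solP //.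
- exact: tower_der_sub.
- exact: (centsP cDD).
- apply: coprime_dvdr co; have ntD : D :!=: 1.
    by apply: contraNneq nta => D1; move: Da; rewrite D1 inE.
  by have [_ pdD _] := pgroup_pdiv pD ntD.
move=> i; rewrite cM ?groupM ?groupX //.
by apply: contra nab => /eqP/(canRL (mulgK _)); rewrite mul1g => ->; rewrite groupV mem_cycle.
Qed.

Lemma tower_cent_le k l : (k <= l)%N -> (l <= h)%N -> 'C_A(P l) \subset 'C(P k).
Proof.
move=> lekl lelh; have sCA : 'C_A(P l) \subset A := subsetIl _ _.
have RT : [~: P l, 'C_A(P l)] \subset T l.
  by rewrite commGC (commG1P _) ?sub1G ?subsetIr.
apply: subset_trans (tower_cent lelh sCA RT) (centS _).
exact: tower_act_P.
Qed.

Lemma tower_card_cent k :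
  (k <= h)%N -> (#|A| <= p ^ k.+1 * #|'C_A(P k)|)%N.
Proof.
elim: k => [|k IHk] lekh.
  rewrite expn1; apply: tower_cent_card => //=.
  by rewrite -abelianE (abelem_abelian abA).
apply: leq_trans (IHk (ltnW lekh)) _.
rewrite [in leqRHS]expnSr -mulnA leq_mul2l.
apply/orP; right; have sCA : 'C_A(P k) \subset A := subsetIl _ _.
have cCX : 'C_A(P k) \subset 'C(X k.+1).
  apply: tower_cent => //; first exact: ltnW.
  by rewrite commGC (commG1P _) ?sub1G ?subsetIr.
apply: leq_trans (tower_cent_card lekh sCA cCX) _.
by rewrite leq_mul2l subset_leq_card ?orbT // setSI.
Qed.

Lemma tower_card_cent_le k l : (k <= l)%N -> (l <= h)%N ->
  (#|'C_A(P k)| <= p ^ (l - k) * #|'C_A(P l)|)%N.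
Proof.
move=> lekl; rewrite -(subnKC lekl); move: (l - k)%N => d; rewrite addKn.
elim: d => [|d IHd] lelh; first by rewrite addn0 mul1n.
rewrite addnS in lelh *; apply: leq_trans (IHd (ltnW lelh)) _.
rewrite expnSr -mulnA leq_mul2l; apply/orP; right.
set i := (k + d)%N; have sCA : 'C_A(P i) \subset A := subsetIl _ _.
have cCX : 'C_A(P i) \subset 'C(X i.+1).
  apply: tower_cent => //; first exact: ltnW.
  by rewrite commGC (commG1P _) ?sub1G ?subsetIr.
apply: leq_trans (tower_cent_card lelh sCA cCX) _.
by rewrite leq_mul2l subset_leq_card ?orbT // setSI.
Qed.

(** * The borderline case *)

Section BorderlineTower.

Variable m : nat.
Hypotheses (defh : h = m.+2) (cardA : (p ^ m.+2 <= #|A|)%N).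
Hypotheses (CA1 : 'C_A(P m.+1) = 1) (Tm1 : T m.+1 = 1%G) (Mh1 : M h = 1%G).

Local Notation Bs := (A :\: 'C(P 0)).

(* If C_G(b) has Fitting height at most m.+1, then [tower_fix b m.+1] is trivial;
   we show that this cannot happen for all b in A that move P 0. *)
Fixpoint tower_fix (b : gT) j : {group gT} :=
  if j is j'.+1 then [~: 'C_(P j'.+2)[b], tower_fix b j']%G else 'C_(P 1)[b]%G.

Let abelA : abelian A := abelem_abelian abA.

Let le1h k : (k <= m.+1)%N -> (k <= h)%N.
Proof. by rewrite defh; apply: leqW. Qed.

(** The cost counted from the bottom up to [k] and from [k] up to [m.+1] leaves no slack. *)
Let card_cent k : (k <= m.+1)%N -> #|'C_A(P k)| = (p ^ (m.+1 - k))%N.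
Proof.
move=> lekm; apply/eqP; rewrite eqn_leq.
have := tower_card_cent_le lekm (le1h (leqnn _)).
rewrite CA1 cards1 muln1 => -> /=.
have := leq_trans cardA (tower_card_cent (le1h lekm)).
have -> : (p ^ m.+2 = p ^ k.+1 * p ^ (m.+1 - k))%N by rewrite -expnD addSn subnKC.
by rewrite leq_pmul2l // expn_gt0 prime_gt0.
Qed.

Let card_A : #|A| = (p ^ m.+2)%N.
Proof.
apply/eqP; rewrite eqn_leq cardA andbT.
by have := tower_card_cent (leq0n h); rewrite card_cent // subn0 -expnD addnC addn1.
Qed.

(** A level centralised by [A] would make [A] centralise [P 0], against [card_cent]. *)
Let coPp k : (k <= h)%N -> coprime #|P k| p.
Proof.
move=> lekh; case/orP: (coPA lekh) => [co | cA].
  by apply: coprime_dvdr co; rewrite card_A dvdn_exp.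
have: A \subset 'C_A(P 0) by rewrite subsetI subxx (subset_trans _ (tower_cent_le (leq0n k) lekh)) // subsetI subxx.
move/subset_leq_card; rewrite card_A card_cent // subn0 leq_exp2l ?prime_gt1 //.
by rewrite ltnn.
Qed.

Let coPB k (B : {group gT}) : (k <= h)%N -> B \subset A -> coprime #|P k| #|B|.
Proof.
by move=> lekh sBA; rewrite (coprimegS sBA) // card_A coprimeXr ?coPp.
Qed.

Let Ap b : b \in A -> b ^+ p = 1.
Proof. by move=> Ab; have [_ ->] := abelemP pr_p abA. Qed.

Let exists_step k : (k < m.+1)%N ->
  exists2 a, a \in 'C_A(P k) & a \notin 'C(P k.+1).
Proof.
move=> ltkm; have /subsetPn[a Ca na] : ~~ ('C_A(P k) \subset 'C_A(P k.+1)).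
  apply: contraL ltkm => /subset_leq_card; rewrite -leqNgt => le_c.
  rewrite leqNgt; apply/negP=> ltkm; move: le_c.
  rewrite !card_cent ?(ltnW ltkm) // leq_exp2l ?prime_gt1 // leqNgt.
  by rewrite ltn_sub2l.
by exists a => //; apply: contra na => ca; rewrite inE ca andbT; case/setIP: Ca.
Qed.

Let exists_b : exists b, b \in Bs.
Proof.
apply/set0Pn; apply/negP; rewrite setD_eq0 => cA.
have /subset_leq_card : A \subset 'C_A(P 0) by rewrite subsetI subxx.
by rewrite card_A card_cent // subn0 leq_exp2l ?prime_gt1 // ltnn.
Qed.

Let BsA b : b \in Bs -> b \in A. Proof. by case/setDP. Qed.

Let b_notT b k : b \in Bs -> (k <= h)%N -> ~~ ([~: P k, <[b]>] \subset T k).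
Proof.
case/setDP=> Ab ncb lekh; apply: contra ncb => RT.
have sbA : <[b]> \subset A by rewrite cycle_subG.
rewrite -cycle_subG (subset_trans (tower_cent lekh sbA RT)) //.
by rewrite centS // tower_act_P.
Qed.

(** ['C_A(P 0)] has index [p] in [A], so [b] and it generate [A]. This and [comm_b0] prepare
    [sub_of_conj_meet] for [R = P 0]. *)
Let cent_b0 b : b \in Bs -> 'C_(P 0)[b] \subset 'C(A).
Proof.
case/setDP=> Ab ncb; have sbA : <[b]> \subset A by rewrite cycle_subG.
have ob : #[b] = p.
  by apply: (abelem_order_p abA) => //; apply: contraNneq ncb => ->; apply: group1.
have defA : <[b]> <*> 'C_A(P 0) = A.
  apply/eqP; rewrite eqEcard join_subG sbA subsetIl /=.
  rewrite norm_joinEl ?(subset_trans sbA) ?sub_abelian_norm ?subsetIl //.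
  rewrite TI_cardMg; last first.
    by rewrite prime_TIg -?orderE ?ob // cycle_subG inE Ab.
  by rewrite -orderE ob card_cent // subn0 -expnS card_A.
rewrite -[in 'C(A)]defA centY cent_cycle subsetI subsetIr /=.
by rewrite (subset_trans (subsetIl _ _)) // centsC subsetIr.
Qed.

Let comm_b0 b : b \in Bs -> P 0 \subset [~: P 0, <[b]>].
Proof.
move=> Bb; have Ab := BsA Bb; apply: contraR (b_notT Bb (leq0n h)) => neq.
have nbA : A \subset 'N(<[b]>) by rewrite sub_abelian_norm ?cycle_subG.
apply: (@tower_maxP 0 [~: P 0, <[b]>]%G) => //.
- by rewrite commg_subl cycle_subG (subsetP (nPA _)).
- by rewrite normsR ?nPA.
by apply: contraNneq neq => /= ->.
Qed.

(* N is pushed up one level at a time by [twisted_subgroup_exists], applied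
   modulo the kernel of the action of the next level. *)
Let twist_chain b k : b \in Bs -> (k <= m.+1)%N ->
  exists N : {group gT}, [/\ N \subset P k, b \in 'N(N), [~: N, N] \subset T k
                           & ~~ ([~: N, <[b]>] \subset T k)].
Proof.
move=> Bb; have Ab := BsA Bb; elim: k => [|k IHk] lekm.
  exists (P 0); split=> //; last exact: b_notT.
    exact: (subsetP (nPA (leq0n h))).
  exact: (tower_der_sub (leq0n h)).
have [N [sNP nNb RNT ncN]] := IHk (ltnW lekm).
have lth := le1h lekm; have leh := ltnW lth.
pose Q := P k.+1; pose T1 := T k.+1; pose T0 := T k.
have sTQ : T1 \subset Q := tower_ker_sub lth.
have sTP0 : T0 \subset P k := tower_ker_sub leh.
have nT1Q : Q \subset 'N(T1) by apply: tower_ker_normP.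
have nT1P : P k \subset 'N(T1) by apply: tower_ker_normP.
have nT1A : A \subset 'N(T1) by rewrite (subset_trans (tower_act_A 0)) ?tower_act_normT.
have nT0A : A \subset 'N(T0) by rewrite (subset_trans (tower_act_A 0)) ?tower_act_normT.
have nT0P : P k \subset 'N(T0) by apply: tower_ker_normP.
have T0Q : [~: T0, Q] \subset T1 by rewrite -sub_tower_ker.
have nT1T0 := subset_trans sTP0 nT1P.
(* Both kernels are factored out at once: [T0] is trivial on [Q] modulo [T1], so [Q] normalises [Y],
   and by coprimeness [Y] meets [Q] only in [T1]. *)
pose Y := (T1 <*> T0)%G.
have defY : Y :=: T1 * T0 by rewrite /= norm_joinEr.
have nYQ : Q \subset 'N(Y).
  apply/subsetP=> u Qu; rewrite inE -genJ gen_subG conjUg subUset.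
  rewrite (normsP nT1Q) // joing_subl; apply/subsetP=> _ /imsetP[t Tt ->].
  rewrite conjg_mulR groupM ?mem_gen ?inE ?Tt ?orbT //.
  by rewrite (subsetP T0Q) ?mem_commg.
have nYP : P k \subset 'N(Y) by rewrite normsY.
have nYA : A \subset 'N(Y) by rewrite normsY.
have nYN := subset_trans sNP nYP.
have nYb : b \in 'N(Y) := subsetP nYA b Ab.
have tiYQ : Y :&: Q \subset T1.
  rewrite defY -group_modl // mul_subG //.
  by rewrite coprime_TIg ?sub1G // (coprimeSg sTP0) // coprime_sym coPP.
have NbP : [~: N, <[b]>] \subset P k.
  by rewrite (subset_trans _ sNP) // commg_subl cycle_subG.
have [|||||||||||||N1 [sN1Q abN1 nN1b ncN1]] :=
  @twisted_subgroup_exists _ (Q / Y)%G (N / Y)%G (coset Y b) p.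
- by rewrite quotient_sol ?solP.
- by rewrite sub_der1_abelian // (subset_trans RNT) // joing_subr.
- by rewrite quotient_norms // (subset_trans sNP) ?nPP.
- by rewrite (subsetP (quotient_norm _ _)) ?mem_quotient // (subsetP (nPA lth)).
- by rewrite (subsetP (quotient_norm _ _)) ?mem_quotient.
- by [].
- by rewrite -morphX // Ap // morph1.
- by rewrite coprime_morphl // (coprimeSg sNP) ?coPp.
- by rewrite coprime_morphl // coPp.
- by rewrite coprime_morphl // coprime_morphr // (coprimegS sNP) ?coPP.
- rewrite -quotientR // quotient_cents2r // commGC.
  rewrite (subset_trans (commgS _ (tower_der_sub lth))) //.
  by rewrite (subset_trans (tower_comm_max lth)) ?joing_subl.
- rewrite -quotientR // quotient_cents2r //.
  rewrite (subset_trans (commgSS (tower_der_sub lth) sNP)) //.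
  by rewrite (subset_trans _ (joing_subl _ _)) // -sub_tower_max ?tower_max_sub.
- apply: contra ncN; rewrite -quotient_cycle // -quotientR ?cycle_subG //.
  rewrite quotient_cents2 ?(subset_trans NbP nYP) //.
  move=> RY; rewrite (sub_tower_ker _ NbP) //; apply: subset_trans tiYQ.
  by rewrite subsetI RY commg_subr (subset_trans NbP) ?nPP.
pose N2 := (Q :&: coset Y @*^-1 N1)%G.
have defN1 : N2 / Y = N1.
  by rewrite [_ / _]morphim_setIpre; apply/setIidPr.
have sN2Q : N2 \subset Q := subsetIl _ _.
exists N2; split=> //.
- rewrite -cycle_subG normsI ?cycle_subG ?(subsetP (nPA lth)) //.
  by rewrite (subsetP (morphpre_norm _ _)) // mem_morphpre.
- apply: subset_trans tiYQ; rewrite subsetI; apply/andP; split.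
    rewrite -quotient_cents2 ?(subset_trans sN2Q) // defN1 //.
  by rewrite (subset_trans (commgSS sN2Q sN2Q)) // commg_subl normG.
apply: contra ncN1 => RT; rewrite -cent_cycle -defN1 -quotient_cycle //.
by rewrite quotient_cents2r // (subset_trans RT) ?joing_subl.
Qed.

Let nPb b k : b \in A -> (k <= h)%N -> b \in 'N(P k).
Proof. by move=> Ab lekh; apply: (subsetP (nPA lekh)). Qed.

Local Notation W := (P m.+1).
Local Notation V := (P m.+2).

Let le2h : (m.+2 <= h)%N. Proof. by rewrite defh. Qed.
Let lt1h : (m.+1 < h)%N. Proof. by rewrite defh. Qed.

Let abelV : abelian V.
Proof.
by apply/commG1P/eqP; rewrite -subG1; have := tower_der_sub le2h; rewrite -defh Mh1.
Qed.

Let cVW (S : {set gT}) : S \subset W -> S \subset 'C(V) -> S \subset [1].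
Proof.
move=> sSW /commG1P RSV; have := sub_tower_ker lt1h sSW.
by rewrite RSV sub1G Tm1.
Qed.

Lemma tower_fix_sub b j : (j <= m.+1)%N -> tower_fix b j \subset 'C_(P j.+1)[b].
Proof.
elim: j => [|j IHj] //= ltjm; have lejm := ltnW ltjm.
have lejh : (j.+2 <= h)%N by rewrite defh ltnS.
have nPE : tower_fix b j \subset 'N(P j.+2).
  by rewrite (subset_trans (IHj lejm)) // (subset_trans (subsetIl _ _)) ?nPP.
have cE : tower_fix b j \subset 'C[b].
  by rewrite (subset_trans (IHj lejm)) // subsetIr.
rewrite commg_subl normsI // (subset_trans cE) //; exact: normG.
Qed.

Lemma tower_fix_commE b j : (j < m.+1)%N ->
  [~: tower_fix b j.+1, tower_fix b j] = tower_fix b j.+1.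
Proof.
move=> ltjm /=; have lejm := ltnW ltjm.
have lejh : (j.+2 <= h)%N by rewrite defh ltnS.
have sEP : tower_fix b j \subset P j.+1.
  by rewrite (subset_trans (tower_fix_sub b lejm)) ?subsetIl.
have cE : tower_fix b j \subset 'C[b].
  by rewrite (subset_trans (tower_fix_sub b lejm)) ?subsetIr.
have sCP : 'C_(P j.+2)[b] \subset P j.+2 := subsetIl _ _.
apply: coprime_commGid.
- apply: normsI; first by rewrite (subset_trans sEP) ?nPP.
  by rewrite (subset_trans cE) ?normG.
- exact: coprimeSg sCP (coprimegS sEP (coPP _)).
exact: solvableS sCP (solP _).
Qed.

Let tower_fix_subP b j : (j <= m.+1)%N -> tower_fix b j \subset P j.+1.
Proof. by move/(tower_fix_sub b)=> s; rewrite (subset_trans s) ?subsetIl. Qed.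

Let tower_fix_norm b j : b \in A -> (j <= m.+1)%N -> A \subset 'N(tower_fix b j).
Proof.
move=> Ab; have nC k : (k <= h)%N -> A \subset 'N('C_(P k)[b]).
  move=> lekh; rewrite normsI ?nPA // (subset_trans _ (normG _)) //.
  by rewrite sub_cent1 (subsetP abelA).
elim: j => [|j IHj] lejm /=; first by rewrite nC // defh.
by rewrite normsR ?nC ?IHj ?defh ?ltnS // ltnW.
Qed.

(** Such an [a] centralises every lower level too. The elements [b * a ^+ i] thus share the lower
    part of the chain, while their fixed points one level higher may differ. *)
Let tower_fix_twist a b i j : (j <= m.+1)%N -> a \in 'C_A(P j.+1) ->
  tower_fix (b * a ^+ i) j = tower_fix b j.
Proof.
move=> lejm /setIP[Aa ca].
have eqC k : (k <= j.+1)%N -> 'C_(P k)[b * a ^+ i] = 'C_(P k)[b].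
  move=> lekj; have lejh : (j.+1 <= h)%N by rewrite defh ltnS.
  have cPa : a \in 'C(P k) by rewrite (subsetP (tower_cent_le lekj lejh)) // inE Aa.
  apply/setP=> x; rewrite !in_setI; case Px: (x \in P k) => //=.
  have cax : a ^+ i \in 'C[x].
    by apply: groupX; apply/cent1P; apply: (centP cPa).
  by rewrite cent1C [RHS]cent1C groupMr.
elim: j lejm {ca} eqC => [|j IHj] lejm eqC; apply/val_inj => /=; first exact: eqC.
by rewrite eqC // (IHj (ltnW lejm)) // => k lekj; apply: eqC; apply: leqW.
Qed.

Let Bs_twist a b i : b \in Bs -> a \in 'C_A(P 0) -> b * a ^+ i \in Bs.
Proof.
case/setDP=> Ab ncb /setIP[Aa ca]; apply/setDP; split.
  by rewrite groupM ?groupX.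
by rewrite groupMr ?groupX.
Qed.

Let cent_a_max k a : (k < m.+1)%N -> a \in 'C_A(P k) -> a \notin 'C(P k.+1) ->
  'C_(P k.+1)[a] \subset M k.+1.
Proof.
move=> ltkm Ca nca; have lekh := le1h ltkm; have [Aa ca] := setIP Ca.
have sCA : 'C_A(P k) \subset A := subsetIl _ _.
have cCX : 'C_A(P k) \subset 'C(X k.+1).
  apply: tower_cent => //; first exact: ltnW.
  by rewrite commGC (commG1P _) ?sub1G ?subsetIr.
have cXa : X k.+1 \subset 'C[a] by rewrite sub_cent1 (subsetP cCX).
apply: tower_maxP => //; first exact: subsetIl.
  by rewrite normsI ?tower_act_normP ?leqnn // (subset_trans cXa) ?normG.
by apply: contraNneq nca => /setIidPl; rewrite sub_cent1.
Qed.

Definition tower_fix_gen j := <<\bigcup_(b in Bs) tower_fix b j>>%G.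

Let tower_fix_mem b j : b \in Bs -> tower_fix b j \subset tower_fix_gen j.
Proof. by move=> Bb; rewrite sub_gen // (bigcup_max b). Qed.

Let tower_fix_gen_sub j : (j <= m.+1)%N -> tower_fix_gen j \subset P j.+1.
Proof.
by move=> lejm; rewrite gen_subG; apply/bigcupsP=> b _; apply: tower_fix_subP.
Qed.

(** The element [a] from [exists_step] has fixed points on the new level only in [M], so
    [rank2_gen_cent] leaves the contribution of the [b * a ^+ i], all in [Bs]; [tower_gen_max] then
    replaces [M] by [T]. *)
Let tower_fix_genP j : (j <= m)%N -> P j.+1 \subset tower_fix_gen j <*> T j.+1.
Proof.
elim: j => [|j IHj] lejm.
  have [a Ca nca] := exists_step (ltn0Sn m); have [b Bb] := exists_b.
  have le1 : (1 <= h)%N by rewrite defh.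
  apply: tower_gen_max => //; first exact: tower_fix_gen_sub.
  have Aa : a \in A by case/setIP: Ca.
  have sMJ : M 1 \subset tower_fix_gen 0 <*> M 1 := joing_subr _ _.
  have Ab := BsA Bb; have cab : commute a b := centsP abelA a Aa b Ab.
  apply: (@rank2_gen_cent _ _ _ a b p); rewrite ?nPb ?Ap ?solP ?coPp //.
  - exact: subset_trans (tower_der_sub le1) sMJ.
  - exact: subset_trans (cent_a_max _ Ca nca) sMJ.
  move=> i; have Bbi := Bs_twist i Bb Ca.
  by rewrite (subset_trans _ (joing_subl _ _)) // (tower_fix_mem 0 Bbi).
have ltjm : (j.+1 < m.+1)%N by rewrite ltnS.
have [a Ca nca] := exists_step ltjm.
have Aa : a \in A by case/setIP: Ca.
have lejh : (j.+2 <= h)%N by rewrite defh !ltnS ltnW.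
have lejh' : (j.+1 < h)%N := lejh.
set Q := P j.+2; have nMQ := normal_norm (tower_max_normal lejh).
apply: tower_gen_max => //; first exact: tower_fix_gen_sub (ltnW ltjm).
set J := (tower_fix_gen j.+1 <*> M j.+2)%G.
have sMJ : M j.+2 \subset J := joing_subr _ _.
have sJQ : J \subset Q by rewrite join_subG (tower_fix_gen_sub (ltnW ltjm)) tower_max_sub.
have sDJ : Q^`(1) \subset J := subset_trans (tower_der_sub lejh) sMJ.
have nJQ : Q \subset 'N(J) by apply: sub_der1_norm.
have sub_cent (S : {group gT}) : S \subset P j.+1 -> [~: Q, S] \subset J ->
    S \subset modcent (P j.+1) Q J.
  move=> sSP RJ; have nJS : S \subset 'N(J).
    by rewrite -commg_subr commGC (subset_trans (commSg _ sJQ)).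
  by rewrite subsetI sSP -sub_quotient_pre // quotient_cents2 // commGC.
suff sPC : P j.+1 \subset modcent (P j.+1) Q J.
  rewrite /Q -(tower_commE lejh') commGC.
  have nJP : P j.+1 \subset 'N(J) by rewrite (subset_trans sPC) // (subset_trans (subsetIr _ _)) ?subsetIl.
  by rewrite -quotient_cents2 // sub_quotient_pre // (subset_trans sPC) ?subsetIr.
apply: subset_trans (IHj (ltnW lejm)) _; rewrite join_subG; apply/andP; split; last first.
  apply: sub_cent; first by rewrite tower_ker_sub // ltnW.
  rewrite commGC (subset_trans _ sMJ) // (subset_trans _ (tower_ker_max lejh)) //.
  by rewrite -sub_tower_ker ?tower_ker_sub // ltnW.
rewrite gen_subG; apply/bigcupsP=> b Bb.
have lejm1 : (j <= m.+1)%N by rewrite (leq_trans (leqnSn j)) // ltnW.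
have sEP := tower_fix_subP b lejm1.
apply: sub_cent => //; set E := tower_fix b j in sEP *.
(* [L] contains ['C_Q[a]], which lies in [M]. It contains each ['C_Q[b * a ^+ i]] because [E] is
   also the term of the chain of [b * a ^+ i], whose next term is the commutator in question. *)
pose L := [set u in Q | [forall e in E, [~ u, e] \in J]].
have LP u : reflect (u \in Q /\ {in E, forall e, [~ u, e] \in J}) (u \in L).
  rewrite inE; apply: (iffP andP) => [] [-> hu]; split=> //; last exact/forall_inP.
  exact/forall_inP.
have gL : group_set L.
  apply/group_setP; split=> [|u v /LP[Qu hu] /LP[Qv hv]].
    by apply/LP; split=> // e _; rewrite comm1g group1.
  apply/LP; split=> [|e Ee]; first exact: groupM.
  by rewrite commMgJ groupM ?hv // memJ_norm ?hu // (subsetP nJQ).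
suff sQL : Q \subset Group gL.
  rewrite gen_subG; apply/subsetP=> _ /imset2P[u e Qu Ee ->].
  by have /LP[_ ->] := subsetP sQL u Qu.
have ECP e : e \in E -> e \in P j.+1 by apply: (subsetP sEP).
have nQP : P j.+1 \subset 'N(Q) by rewrite nPP.
have Ca0 : a \in 'C_A(P 0).
  rewrite inE Aa (subsetP (tower_cent_le (leq0n j.+1) _) a Ca) //.
  exact: ltnW.
have Ab := BsA Bb; have cab : commute a b := centsP abelA a Aa b Ab.
apply: (@rank2_gen_cent _ _ _ a b p); rewrite ?nPb ?Ap ?solP ?coPp //.
- apply/subsetP=> u Du; apply/LP; split; first exact: (subsetP (der_sub 1 Q)).
  move=> e Ee; apply: (subsetP sDJ); rewrite commgEl groupM ?groupV //.
  rewrite memJ_norm //; apply: (subsetP (gFnorm_trans _ nQP)); exact: ECP.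
- apply/subsetP=> u Cu; apply/LP; split; first by case/setIP: Cu.
  move=> e Ee; apply: (subsetP sMJ); apply: (subsetP (tower_ker_max lejh)).
  have Mu := subsetP (cent_a_max ltjm Ca nca) u Cu.
  have : [~: M j.+2, P j.+1] \subset T j.+2 by rewrite -sub_tower_max ?tower_max_sub.
  by move/subsetP; apply; apply: mem_commg => //; apply: ECP.
move=> i; apply/subsetP=> u Cu; apply/LP; split; first by case/setIP: Cu.
move=> e Ee; have Bbi := Bs_twist i Bb Ca0.
apply: (subsetP (joing_subl _ _)); apply: (subsetP (tower_fix_mem j.+1 Bbi)).
by rewrite /= mem_commg // tower_fix_twist.
Qed.

Hypothesis dead : forall b, b \in Bs -> tower_fix b m.+1 :=: 1.

Local Notation Z := 'Z(W)%G.

Let nWV : W \subset 'N(V). Proof. exact: nPP. Qed.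

Let coVW : coprime #|V| #|W|. Proof. exact: coPP. Qed.

Let sZW : Z \subset W. Proof. exact: center_sub. Qed.

Let dead_cent b : b \in Bs -> 'C_V[b] \subset 'C(tower_fix b m).
Proof. by move=> Bb; apply/commG1P; apply: (dead Bb). Qed.

Let fixW b : tower_fix b m \subset W.
Proof. exact: tower_fix_subP (leqnSn m). Qed.

Let fix_centb b : tower_fix b m \subset 'C[b].
Proof. by rewrite (subset_trans (tower_fix_sub b (leqnSn m))) ?subsetIr. Qed.

(** ['C_V[b]] centralises [E], while [E] has no fixed points in [[~: V, E]]; so neither has [b], and
    [comm_sub_of_cent_sub] applies to the abelian group [Z] with trivial [S]. *)
Let dead_comm b : b \in Bs ->
  [~: [~: V, tower_fix b m], [~: Z, <[b]>]] = 1.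
Proof.
move=> Bb; have Ab := BsA Bb; set E := tower_fix b m.
have nVE : E \subset 'N(V) := subset_trans (fixW b) nWV.
have sUV : [~: V, E] \subset V by rewrite commg_subl.
have nVZ : Z \subset 'N(V) := subset_trans sZW nWV.
have nEZ : Z \subset 'N(E).
  by rewrite cents_norm // (subset_trans (subsetIr _ _)) ?centS ?fixW.
apply/trivgP; apply: (@comm_sub_of_cent_sub _ _ _ 1%G b p); rewrite ?norm1 ?in_setT //.
- exact: abelianS abelV.
- exact: center_abelian.
- exact: normsR.
- rewrite -cycle_subG normsR // cycle_subG ?nPb //.
  by rewrite (subsetP (tower_fix_norm Ab (leqnSn m))).
- rewrite -cycle_subG gFnorm_trans // cycle_subG nPb //; exact: ltnW.
- exact: Ap.
- by rewrite (coprimeSg sZW) ?coPp // ltnW.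
- exact: coprimeSg sUV (coprimegS sZW coVW).
- exact: sub1G.
have tiE : 'C_[~: V, E](E) = 1.
  by apply: coprime_abel_cent_TI => //; apply: coprimegS (fixW b) coVW.
by rewrite /= -tiE subsetI subsetIl (subset_trans (setSI _ sUV)) // dead_cent.
Qed.

Let fix_genW : tower_fix_gen m :=: W.
Proof.
apply/eqP; rewrite eqEsubset tower_fix_gen_sub //=.
have := tower_fix_genP (ltnSn m).
by rewrite Tm1 joingG1.
Qed.

(* If Y = [Z(W), P 0] is nontrivial, let Xm be a minimal W-invariant subgroup of
   [V, Y]. As W is generated by the [tower_fix b m], for every x in P 0 some
   b ^ x has [Z(W), b ^ x] centralising a nontrivial part of Xm, hence Xm; then
   [sub_of_conj_meet] shows that Y centralises Xm, which is absurd. *)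
Let center_cent0 : Z \subset 'C(P 0).
Proof.
have le0h : (0 <= h)%N by []; have nZA : A \subset 'N(Z).
  by rewrite gFnorm_trans // nPA // ltnW.
have nZ0 : P 0 \subset 'N(Z) by rewrite gFnorm_trans // nPP // ltnW.
have nVZ : Z \subset 'N(V) := subset_trans sZW nWV.
pose Y := [~: Z, P 0]%G; have sYZ : Y \subset Z by rewrite commg_subl.
have sYW := subset_trans sYZ sZW.
have cYW : W \subset 'C(Y) by rewrite centsC (subset_trans sYZ) ?subsetIr.
have nVY : Y \subset 'N(V) := subset_trans sYW nWV.
rewrite -[_ \subset _]/(Z \subset 'C(P 0)); apply/commG1P/eqP.
rewrite -[_ == _]/(Y :==: 1); apply: contraT => ntY.
have ntVY : [~: V, Y] :!=: 1.
  apply: contra ntY => /eqP/commG1P; rewrite centsC => cVY.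
  by rewrite -subG1; apply: cVW.
have minex : exists H : {group gT}, (H :!=: 1) && (W \subset 'N(H)) && (H \subset [~: V, Y]).
  by exists [~: V, Y]%G; rewrite ntVY subxx andbT normsR ?(cents_norm cYW).
case: (@ex_mingroup _ (fun H => (H :!=: 1) && (W \subset 'N(H)) && (H \subset [~: V, Y]))) => //.
move=> Xm /mingroupP[/andP[/andP[ntX nXW] sXVY] minX].
have sVYV : [~: V, Y] \subset V by rewrite commg_subl.
have sXV := subset_trans sXVY sVYV.
have tiXY : Xm \subset 'C(Y) -> False.
  move=> cXY; move: ntX; rewrite -subG1 => /negP[].
  have <- : 'C_[~: V, Y](Y) = 1.
    by apply: coprime_abel_cent_TI => //; apply: coprimegS sYW coVW.
  by rewrite subsetI sXVY.
(* [L] acts trivially on [Z] modulo the centraliser of [Xm]; once it contains [P 0], [Y] centralises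
   [Xm]. *)
pose K := 'C_Z(Xm)%G; pose L := modcent_group (P 0 <*> A) Z K.
have sL x : x \in P 0 <*> A -> [~: Z, <[x]>] \subset 'C(Xm) -> x \in L.
  move=> Rx cRX; have nZx : <[x]> \subset 'N(Z).
    by rewrite cycle_subG (subsetP _ x Rx) // join_subG nZ0.
  have RK : [~: Z, <[x]>] \subset K by rewrite subsetI cRX commg_subl nZx.
  have nKx : <[x]> \subset 'N(K).
    by rewrite -commg_subr commGC (subset_trans (commSg _ _) RK) ?subsetIl.
  have nKZ : Z \subset 'N(K) by rewrite sub_abelian_norm ?center_abelian ?subsetIl.
  rewrite -cycle_subG subsetI cycle_subG Rx -sub_quotient_pre //.
  by rewrite quotient_cents2 // commGC.
suff sP0L : P 0 \subset L.
  case: tiXY; rewrite centsC; apply: subset_trans (subsetIr Z _).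
  have nKP : P 0 \subset 'N(K) by rewrite (subset_trans sP0L) // (subset_trans (subsetIr _ _)) ?subsetIl.
  have nKZ : Z \subset 'N(K) by rewrite sub_abelian_norm ?center_abelian ?subsetIl.
  rewrite -quotient_cents2 // centsC sub_quotient_pre //.
  by rewrite (subset_trans sP0L) // subsetIr.
apply: (@sub_of_conj_meet _ p _ A L Bs) => //.
- by case/and3P: abA.
- by rewrite /pgroup p'natE // -prime_coprime // coprime_sym coPp.
- exact: nPA.
- exact: modcent_sub.
- exact: subsetDl.
move=> x P0x; have eqWx : W :^ x = W.
  by rewrite (normsP (nPP (leq0n m.+1) _)) // ltnW.
have eqVx : V :^ x = V by rewrite (normsP (nPP (leq0n m.+2) _)).
have eqZx : Z :^ x = Z by rewrite (normsP nZ0).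
have [b Bb ncE] : exists2 b, b \in Bs & ~~ (tower_fix b m :^ x \subset 'C(Xm)).
  apply/exists_inP; apply: contraT; rewrite negb_exists_in => /forall_inP cE.
  case: tiXY.
  rewrite centsC (subset_trans sYW) // -eqWx -fix_genW.
  rewrite sub_conjg gen_subG; apply/bigcupsP=> b Bb; rewrite -sub_conjg.
  by have := cE b Bb; rewrite negbK.
exists b => //; have Ab := BsA Bb; set E := tower_fix b m in ncE.
apply: sL; first by rewrite groupJ ?mem_gen ?inE ?Ab ?P0x ?orbT.
have sEW : E :^ x \subset W by rewrite -eqWx conjSg fixW.
have nXE : E :^ x \subset 'N(Xm) := subset_trans sEW nXW.
pose C := 'C_Xm([~: Z, <[b ^ x]>])%G.
suff <- : C :=: Xm by rewrite centsC subsetIr.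
have sRZ : [~: Z, <[b ^ x]>] \subset Z.
  by rewrite commg_subl cycle_subG groupJ ?(subsetP nZA b Ab) ?(subsetP nZ0 x P0x).
apply: minX; last exact: subsetIl.
rewrite (subset_trans (subsetIl _ _) sXVY) andbT; apply/andP; split; last first.
  rewrite normsI // (subset_trans _ (normG _)) // centsC.
  by rewrite (subset_trans sRZ) ?subsetIr.
(* This commutator lies in [[~: V, E] :^ x], which [[~: Z, <[b]>] :^ x] centralises by [dead_comm];
   so it is a nontrivial part of [C]. *)
have: [~: Xm, E :^ x] != 1.
  by apply: contra ncE => /eqP/commG1P; rewrite centsC.
apply: contra => /eqP tiC; rewrite -subG1 -tiC subsetI commg_subl nXE /=.
have -> : [~: Z, <[b ^ x]>] = [~: Z, <[b]>] :^ x.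
  by rewrite conjsRg eqZx cycleJ.
apply: subset_trans (commSg _ sXV) _; rewrite -eqVx -conjsRg centJ conjSg.
by apply/commG1P; apply: dead_comm.
Qed.

(** Otherwise [P 0] centralises [W], and [tower_descend] brings this down to [P 1], which is its own
    commutator with [P 0]. *)
Let W_nonabelian : ~~ abelian W.
Proof.
apply/negP=> abW; have defZ : Z :=: W by apply/center_idP.
have RW0 : [~: W, P 0] \subset T m.+1.
  by rewrite -defZ (commG1P center_cent0) sub1G.
have le0h : (0 < h)%N by rewrite defh.
case/negP: (tower_not_ker le0h); rewrite -(tower_commE le0h).
have lem : (m.+1 <= h)%N by apply: ltnW.
elim: (m) lem RW0 => [|k IHk] lekh RWk //.
apply: IHk (ltnW lekh) _; apply: tower_descend RWk => //.
- by apply: nPP => //; apply: ltnW.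
- exact: nPP.
exact: tower_ker_normP.
Qed.

Let defZ : Z :=: M m.+1.
Proof.
have lem : (m.+1 <= h)%N by apply: ltnW.
apply/eqP; rewrite eqEsubset; apply/andP; split.
  apply: tower_maxP => //.
    by rewrite gFnorm_trans // tower_act_normP // leqnn.
  by apply: contra W_nonabelian => /eqP/center_idP.
rewrite subsetI tower_max_sub // centsC; apply/commG1P/eqP.
by have := tower_comm_max lem; rewrite Tm1 -subG1.
Qed.

Let ZP k : (k <= m.+1)%N -> P k \subset 'C(Z).
Proof.
elim: k => [|k IHk] lekm; first by rewrite centsC center_cent0.
have lekh : (k < h)%N by rewrite defh ltnS ltnW.
have nZ : P k.+1 \subset 'N(Z) by rewrite gFnorm_trans // nPP // ltnW.
have cZ : [~: P k, Z] = 1 by apply/commG1P; apply: IHk (ltnW lekm).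
rewrite -(tower_commE lekh); apply/commG1P.
apply: three_subgroup; first by rewrite cZ comm1G.
apply/commG1P; rewrite centsC (subset_trans (IHk (ltnW lekm))) ?centS //.
by rewrite commg_subl.
Qed.

(** Every level below the top centralises [Z], so ['C_V(Y)] is invariant under all that acts on [V]:
    it is [V], excluded by faithfulness of [W], or inside the trivial [M h]. *)
Let center_orbit (Y : {group gT}) : Y \subset Z -> A \subset 'N(Y) ->
  Y :!=: 1 -> 'C_V(Y) = 1.
Proof.
move=> sYZ nYA ntY; have nYX k : (k <= m.+2)%N -> X k \subset 'N(Y).
  elim: k => //= k IHk ltk; rewrite join_subG IHk ?(ltnW ltk) //.
  by rewrite cents_norm // (subset_trans (ZP ltk)) ?centS.
have nVX : X m.+2 \subset 'N(V) by rewrite tower_act_normP ?leqnn.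
apply/trivgP; rewrite -[1]/(gval 1%G) -Mh1 defh.
apply: (tower_maxP (Q := 'C_V(Y)%G)) => //; first exact: subsetIl.
  by rewrite normsI ?norms_cent ?nYX.
apply: contra ntY => /eqP/setIidPl; rewrite centsC => cYV.
by rewrite -subG1 (cVW _ cYV) ?(subset_trans sYZ).
Qed.

(** [twist_chain] yields an abelian subgroup of [W] moved by [b]; without fixed points of [b] in
    [V], its commutator with [b] would centralise [V]. *)
Let cent_fix_nontriv b : b \in Bs -> 'C_V[b] != 1.
Proof.
move=> Bb; have Ab := BsA Bb; have lem : (m.+1 <= h)%N by apply: ltnW.
have [N [sNW nNb RN ncN]] := twist_chain Bb (leqnn m.+1).
apply: contra ncN => /eqP tiC; rewrite Tm1 in RN *.
have nNB : <[b]> \subset 'N(N) by rewrite cycle_subG.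
have sRW : [~: N, <[b]>] \subset W by rewrite (subset_trans _ sNW) // commg_subl.
apply: cVW => //; rewrite centsC; apply/commG1P/trivgP.
apply: (@comm_sub_of_cent_sub _ _ _ 1%G b p); rewrite ?norm1 ?in_setT ?sub1G //.
- by apply/commG1P/trivgP.
- exact: subset_trans sNW nWV.
- exact: nPb.
- exact: Ap.
- by rewrite (coprimeSg sNW) ?coPp.
- exact: coprimegS sNW coVW.
by rewrite tiC.
Qed.

(** Above the first level, coprime action splits the fixed points [C] as [[~: C, F]], which is the
    abelian term itself, times ['C_C(F)], which commutes with it by three subgroups. *)
Let cent_fix_abelian b j : (j <= m)%N -> abelian (tower_fix b j) ->
  [~: (P j.+1)^`(1), P j] = 1 -> 'C_(P j.+1)[b] \subset 'C(tower_fix b j).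
Proof.
case: j => [|j] ltjm //= abE RP.
have lejm : (j <= m.+1)%N by rewrite ltnW // ltnW.
have ltjh : (j.+1 < h)%N by rewrite defh !ltnS ltnW.
set C := 'C_(P j.+2)[b]%G; rewrite -[_ :&: _]/(gval C); set F := tower_fix b j.
have sFP : F \subset P j.+1 := tower_fix_subP b lejm.
have sCP : C \subset P j.+2 := subsetIl _ _.
have cF : F \subset 'C[b].
  by rewrite (subset_trans (tower_fix_sub b lejm)) // subsetIr.
have nCF : F \subset 'N(C).
  apply: normsI; first by rewrite (subset_trans sFP) ?nPP.
  by rewrite (subset_trans cF) // normG.
have coCF : coprime #|C| #|F| by apply: coprimeSg sCP (coprimegS sFP (coPP _)).
have solC : solvable C by rewrite (solvableS sCP) ?solP.
rewrite -{1}(coprime_cent_prod nCF coCF solC) mul_subG //.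
rewrite centsC; apply/commG1P. apply: three_subgroup.
  by rewrite [[~: F, _]]commGC (commG1P (subsetIr _ _)) comm1G.
apply/trivgP; rewrite -RP commgSS // commgSS //.
exact: subset_trans (subsetIl _ _) sCP.
Qed.

(** For [E = tower_fix b m] nontrivial, [dead_comm] and [center_orbit] give that [b] centralises
    [Z]. Then [E] meets [Z]: if nonabelian, by its derived subgroup; if abelian, because [[~: W,
    <[b]>]] and ['C_W[b]] both centralise it. Now ['C_V[b]] centralises [E :&: Z], so [center_orbit]
    makes it trivial, against [cent_fix_nontriv]. *)
Lemma tower_fix_not_all_trivial : False.
Proof.
have lem : (m.+1 <= h)%N by apply: ltnW.
have nZA : A \subset 'N(Z) by rewrite gFnorm_trans // nPA.
have [b Bb ntE] : exists2 b, b \in Bs & tower_fix b m :!=: 1.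
  apply/exists_inP; apply: contraT; rewrite negb_exists_in => /forall_inP tE.
  case/negP: (tower_not_ker lem); rewrite -fix_genW gen_subG.
  apply/bigcupsP=> b Bb; have := tE b Bb; rewrite negbK => /eqP->.
  exact: sub1G.
have Ab := BsA Bb; set E := tower_fix b m in ntE.
have nEA : A \subset 'N(E) := tower_fix_norm Ab (leqnSn m).
have nbA : A \subset 'N(<[b]>) by rewrite sub_abelian_norm // cycle_subG.
have sEW : E \subset W := fixW b.
have nVE := subset_trans sEW nWV.
have nZb : <[b]> \subset 'N(Z) by rewrite cycle_subG (subsetP nZA).
have ntVE : [~: V, E] != 1.
  apply: contra ntE => /eqP/commG1P; rewrite centsC => cVE.
  by rewrite -subG1; apply: cVW.
have cZb : [~: Z, <[b]>] = 1.
  apply: contraNeq ntVE => ntR; rewrite -subG1.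
  rewrite -(center_orbit (Y := [~: Z, <[b]>]%G)) ?normsR ?commg_subl //.
  by rewrite subsetI commg_subl nVE; apply/commG1P; apply: dead_comm.
have sDZ : W^`(1) \subset Z by rewrite /= defZ tower_der_sub.
have ntE0 : E :&: Z != 1.
  have [abE | nabE] := boolP (abelian E); last first.
    apply: contraNneq nabE => tiEZ; apply/commG1P/trivgP; rewrite -tiEZ.
    by rewrite subsetI commg_subl normG (subset_trans _ sDZ) // commgSS.
  suff sEZ : E \subset Z by rewrite (setIidPl sEZ).
  have nWb : <[b]> \subset 'N(W) by rewrite cycle_subG nPb.
  have coWb : coprime #|W| #|<[b]>| by rewrite coPB // cycle_subG.
  rewrite subsetI sEW centsC -(coprime_cent_prod nWb) ?coWb ?solP // mul_subG //.
    apply/commG1P; apply: three_subgroup.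
      have cEb : [~: <[b]>, E] = 1.
        by rewrite commGC; apply/commG1P; rewrite cent_cycle fix_centb.
      by rewrite cEb comm1G.
    apply/trivgP; rewrite -cZb commSg // (subset_trans _ sDZ) //.
    by rewrite commSg.
  rewrite cent_cycle cent_fix_abelian //.
  apply/commG1P; apply: subset_trans sDZ _; rewrite centsC.
  by apply: ZP; apply: leqnSn.
case/eqP: (cent_fix_nontriv Bb); apply/trivgP.
rewrite -[1 in X in _ \subset X](center_orbit (subsetIr E Z) (normsI nEA nZA) ntE0).
by rewrite subsetI subsetIl (subset_trans (dead_cent Bb)) // centS ?subsetIl.
Qed.

End BorderlineTower.

End MinimalTower.

(** * Subgroups, quotients and the exclusion of tall towers *)

Lemma fitting_height_leS gT (G H : {group gT}) n :
  H \subset G -> fitting_height_le G n -> fitting_height_le H n.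
Proof.
move=> sHG /fitting_height_lnil[k Gk]; apply/fitting_height_lnil; exists k.
by apply/trivGP; rewrite -[1]/(gval 1%G) -Gk lnilS.
Qed.

Lemma fitting_height_le_morphim gT (rT : finGroupType) (D : {group gT})
    (f : {morphism D >-> rT}) (G : {group gT}) n :
  G \subset D -> fitting_height_le G n -> fitting_height_le (f @* G) n.
Proof.
move=> sGD /fitting_height_lnil[k Gk]; apply/(@fitting_height_lnil _ (f @* G)%G).
by exists k; apply/val_inj; rewrite /= -lnil_morphim // Gk morphim1.
Qed.

(** The trivial intersection lets [A] keep its order modulo subgroups of [G]. *)
Definition small_cent_height (p n : nat) (gT : finGroupType) (A G : {group gT}) :=
  [/\ p.-abelem A, pgood p A G, solvable G, A :&: G = 1
    & forall a, a \in A^# -> fitting_height_le 'C_G[a] n].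

Lemma small_cent_heightS p n (gT : finGroupType) (A G H : {group gT}) :
  small_cent_height p n A G -> H \subset G -> A \subset 'N(H) ->
  small_cent_height p n A H.
Proof.
case=> abA gAG solG tiAG fhC sHG nHA; split=> //.
- exact: pgoodS gAG.
- exact: solvableS solG.
- by apply/trivgP; rewrite -tiAG setIS.
by move=> a /fhC; apply: (@fitting_height_leS _ 'C_G[a]%G 'C_H[a]%G); rewrite setSI.
Qed.

(** By [pgood_cent_mod] for [<[a]>], elements commuting with [a] modulo [N] are fixed points of [a]
    times elements of [N]; so centralisers in the quotient are images of centralisers. *)
Lemma small_cent_height_quotient p n (gT : finGroupType) (A G N : {group gT}) :
  small_cent_height p n A G -> N <| G -> A \subset 'N(N) ->
  small_cent_height p n (A / N) (G / N).
Proof.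
case=> abA gAG solG tiAG fhC /andP[sNG nNG] nNA; split.
- exact: quotient_abelem.
- exact: pgood_quotient.
- exact: quotient_sol.
- by rewrite -quotientIG // tiAG quotient1.
move=> x /setD1P[ntx /morphimP[a nNa Aa defx]]; rewrite defx in ntx *.
have nta : a \in A^#.
  by rewrite !inE Aa andbT; apply: contraNneq ntx => ->; rewrite morph1.
have sCD : 'C_G[a] \subset 'N(N) := subset_trans (subsetIl _ _) nNG.
have := @fitting_height_le_morphim _ _ _ (coset N) 'C_G[a]%G n sCD (fhC a nta).
apply: (@fitting_height_leS _ ('C_G[a] / N)%G 'C_(G / N)[coset N a]%G) => /=.
pose H := modcent_group G <[a]> N; have naN : <[a]> \subset 'N(N) by rewrite cycle_subG.
have sHG : H \subset G := modcent_sub _ _ _.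
have sNH : N \subset H.
  by rewrite sub_modcent // commg_subl.
have sbA : <[a]> \subset A by rewrite cycle_subG.
have nHa : <[a]> \subset 'N(H).
  apply: modcent_norm; rewrite ?normG //.
  by rewrite (subset_trans sbA) //; case/and3P: gAG.
have gaH : pgood p <[a]> H := pgoodS sbA sHG nHa gAG.
have := pgood_cent_mod gaH (solvableS sHG solG) sNH naN (subset_trans sHG nNG).
rewrite modcent_comm // => /(_ isT) sHC.
apply: (@subset_trans _ _ (H / N)).
  apply/subsetP=> _ /setIP[/morphimP[y nNy Gy ->]] cya.
  rewrite mem_quotient // inE Gy /= -sub1set -sub_quotient_pre ?sub1set //.
  rewrite quotient_cycle // cent_cycle quotient_set1 // sub1set.
  exact: cya.
rewrite (subset_trans (quotientS N sHC)) // quotientMidl quotientS //.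
by rewrite cent_cycle setSI.
Qed.

Lemma quotient_tower gT (A N : {group gT}) q h (P : nat -> {group gT}) :
    tower A q h P -> (forall i, (i <= h)%N -> P i \subset 'N(N)) ->
    ~~ (tower_comm P h \subset N) ->
  tower (A / N) q h (fun i => P i / N)%G.
Proof.
case=> Pq nPP neq_q _ nNP ntD; split=> //.
- move=> i leih; have [pr_q qP nPA] := Pq i leih.
  by split; rewrite ?quotient_pgroup ?quotient_norms.
- by move=> i j /nPP nij; rewrite quotient_norms.
apply: contra ntD => /eqP D1.
rewrite -quotient_sub1 ?(subset_trans (tower_comm_sub nPP (leqnn h))) ?nNP //.
rewrite (@tower_comm_quotient _ P h h N (fun i => P i / N)%G) ?D1 //.
by move=> i leih; split=> //; apply: nNP.
Qed.

Lemma exists_min_tower gT (A : {group gT}) q h (P : nat -> {group gT}) :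
    tower A q h P ->
  (forall R : nat -> {group gT}, (forall i, (i <= h)%N -> R i \subset P i) ->
     tower A q h R ->
     (forall Q : nat -> {group gT}, (forall i, (i <= h)%N -> Q i \subset R i) ->
        tower A q h Q -> forall i, (i <= h)%N -> Q i :=: R i) -> False) ->
  False.
Proof.
have [n] := ubnP (\sum_(i < h.+1) #|P i|); elim: n P => // n IHn P ltPn towP noR.
apply: (noR P) => // Q sQP towQ i leih; apply/eqP; apply: contraT => neqQP.
case: (IHn Q) => // [|R sRQ]; last first.
  by apply: noR => j lejh; apply: subset_trans (sRQ j lejh) (sQP j lejh).
apply: (@leq_trans (\sum_(i < h.+1) #|P i|)) => //.
rewrite (bigD1 (Ordinal (leih : i < h.+1)%N)) //=.
rewrite [ltnRHS](bigD1 (Ordinal (leih : i < h.+1)%N)) //= -addSn leq_add //.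
  by rewrite proper_card // properEneq neqQP sQP.
by apply: leq_sum => j _; rewrite subset_leq_card ?sQP // -ltnS.
Qed.

Lemma pgood_tower_coprime p gT (A G : {group gT}) q h (P : nat -> {group gT}) :
    prime p -> pgood p A G -> tower A q h P -> (forall i, (i <= h)%N -> P i \subset G) ->
  forall i, (i <= h)%N -> coprime #|P i| #|A| || (A \subset 'C(P i)).
Proof.
move=> pr_p gAG [Pq _ _ _] sPG i leih; have [pr_q qP nPA] := Pq i leih.
have gAP := pgoodS (subxx A) (sPG i leih) nPA gAG; have [eqp | neqp] := eqVneq (q i) p.
  by rewrite (pgood_pgroup_cent gAP) ?orbT // -eqp.
have [pA _ _] := and3P gAG; rewrite (pnat_coprime qP) //.
apply: sub_in_pnat pA => r _ /eqnP->; by rewrite !inE eq_sym.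
Qed.

(** The count leaves a nontrivial [a] centralising level [n], hence all levels; their [n + 1]
    nontrivial terms are one too many for ['C_G[a]]. *)
Lemma small_cent_height_tower_max p n gT (A G : {group gT}) q (P : nat -> {group gT}) :
    prime p -> small_cent_height p n A G -> (p ^ n.+2 <= #|A|)%N ->
    tower A q n P -> (forall i, (i <= n)%N -> P i \subset G) ->
  False.
Proof.
move=> pr_p [abA gAG solG tiAG fhC] cardA towP sPG.
apply: (exists_min_tower towP) => R sRP towR minR.
have {}sRG i : (i <= n)%N -> R i \subset G by move=> lei; rewrite (subset_trans (sRP i lei)) ?sPG.
have coRA := pgood_tower_coprime pr_p gAG towR sRG.
have: (1 < #|'C_A(R n)|)%N.
  have := leq_trans cardA (tower_card_cent pr_p abA towR coRA minR (leqnn n)).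
  rewrite expnS mulnC leq_pmul2l ?expn_gt0 ?prime_gt0 //.
  exact: leq_trans (prime_gt1 pr_p).
rewrite cardG_gt1 => /trivgPn[a Ca nta]; have Aa : a \in A by case/setIP: Ca.
case/negP: (tower_not_ker towR minR (leqnn n)).
have -> : R n :=: 1; last exact: sub1G.
apply: (@comm_chain_height _ 'C_G[a]%G R n).
- move=> i lein; rewrite subsetI sRG //= sub_cent1.
  by rewrite (subsetP (tower_cent_le abA towR coRA minR lein (leqnn n))).
- by move=> i ltin; rewrite (tower_commE towR minR).
by apply: fhC; rewrite !inE nta.
Qed.

(* Induction on the size of the tower over all groups: quotients kill
   [tower_max] at the top and [tower_ker] one level below. *)
Lemma small_cent_height_tower p n : prime p -> (0 < n)%N ->
  forall gT (A G : {group gT}) q (P : nat -> {group gT}),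
    small_cent_height p n A G -> (p ^ n.+1 <= #|A|)%N ->
    tower A q n.+1 P -> (forall i, (i <= n.+1)%N -> P i \subset G) ->
  False.
Proof.
move=> pr_p; case: n => // m _ gT A G q P; have [N] := ubnP (\sum_(i < m.+3) #|P i|).
elim: N => // N IHN in gT A G P *; move=> ltPN smallG cardA towP sPG.
apply: (exists_min_tower towP) => {towP} R sRP towR minR.
have {ltPN} ltRN : (\sum_(i < m.+3) #|R i| <= N)%N.
  rewrite -ltnS (leq_trans _ ltPN) // ltnS leq_sum // => i _.
  by rewrite subset_leq_card ?sRP // -ltnS.
have {sPG sRP P} sRG i : (i <= m.+2)%N -> R i \subset G.
  by move=> lei; rewrite (subset_trans (sRP i lei)) ?sPG.
have [abA gAG _ tiAG fhC] := smallG.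
have coRA := pgood_tower_coprime pr_p gAG towR sRG.
have [Rq nRR neq_q ntR] := towR.
(* In the group generated by the levels, the kernels to be factored out are normal. *)
pose G1 := <<\bigcup_(i < m.+3) R i>>%G.
have sRG1 i : (i <= m.+2)%N -> R i \subset G1.
  move=> lei; rewrite sub_gen //.
  exact: (bigcup_max (Ordinal (lei : i < m.+3)%N)).
have nG1P (B : {group gT}) : (forall i, (i <= m.+2)%N -> B \subset 'N(R i)) ->
    B \subset 'N(G1).
  move=> nRB; rewrite norms_gen // norms_bigcup //.
  by apply/bigcapsP=> i _; rewrite nRB // -ltnS.
have small1 : small_cent_height p m.+1 A G1.
  apply: small_cent_heightS smallG _ (nG1P _ _) => [|i /Rq[] //].
  by rewrite gen_subG; apply/bigcupsP=> i _; rewrite sRG // -ltnS.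
have nt_quotient (K : {group gT}) j : (j <= m.+2)%N -> K \subset R j ->
    A \subset 'N(K) -> (forall i, (i <= m.+2)%N -> R i \subset 'N(K)) ->
    ~~ (R m.+2 \subset K) -> K = 1%G.
  move=> lej sKR nKA nKR nsK; apply/trivGP; rewrite subG1; apply: contraT => ntK.
  have nsKG1 : K <| G1.
    rewrite /normal (subset_trans sKR) ?sRG1 // gen_subG.
    by apply/bigcupsP=> i _; rewrite nKR // -ltnS.
  case: (IHN _ (A / K)%G (G1 / K)%G (fun i => R i / K)%G).
  - apply: leq_trans ltRN; rewrite (bigD1 (Ordinal (lej : j < m.+3)%N)) //=.
    rewrite [ltnRHS](bigD1 (Ordinal (lej : j < m.+3)%N)) //= -addSn leq_add //.
      by rewrite ltn_quotient.
    by apply: leq_sum => i _; apply: leq_quotient.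
  - exact: small_cent_height_quotient.
  - have tiKA : K :&: A = 1.
      by rewrite setIC; apply/trivgP; rewrite -tiAG setIS // (subset_trans sKR) ?sRG.
    by rewrite -(card_isog (quotient_isog nKA tiKA)).
  - by apply: quotient_tower => //; rewrite (tower_comm_min towR minR).
  by move=> i lei; rewrite quotientS ?sRG1.
have TM1 : tower_max m.+2 R m.+2 = 1%G.
  apply: (nt_quotient _ m.+2) => //.
  - exact: tower_max_sub.
  - exact: subset_trans (tower_act_A A R m.+2) (tower_act_normM towR _).
  - move=> i; rewrite leq_eqVlt => /predU1P[-> | ltih].
      by rewrite normal_norm // (tower_max_normal towR minR).
    exact: subset_trans (tower_act_P A R ltih) (tower_act_normM towR _).
  exact: (tower_not_max towR minR).
have Tm1 : tower_ker m.+2 R m.+1 = 1%G.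
  have sTR : tower_ker m.+2 R m.+1 \subset R m.+1 := tower_ker_sub R (leqnSn _).
  apply: (nt_quotient _ m.+1) => //.
  - apply: subset_trans (tower_act_A A R m.+1) (tower_act_normT towR _).
    by rewrite leqnn leqnSn.
  - move=> i; rewrite leq_eqVlt => /predU1P[-> | ltih].
      rewrite cents_norm // centsC; apply/commG1P/trivgP.
      by rewrite -[1]/(gval 1%G) -(tower_ker_last m.+2 R) -(sub_tower_ker towR).
    exact: (tower_ker_normP towR).
  apply: contra ntR => sRT; rewrite (tower_comm_min towR minR) //.
  have := coprime_TIg (tower_coprime towR (ltnSn _)).
  by rewrite (setIidPl (subset_trans sRT sTR)) => ->.
(* A nontrivial [a] centralising level [m.+1] centralises levels [0] to [m.+1], already too many for
   ['C_G[a]]. *)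
have [CA1 | ntC] := eqVneq 'C_A(R m.+1) 1; last first.
  have /trivgPn[a Ca nta] := ntC; have Aa : a \in A by case/setIP: Ca.
  case/negP: (tower_not_ker towR minR (leqnSn m.+1)).
  have -> : R m.+1 :=: 1; last exact: sub1G.
  apply: (@comm_chain_height _ 'C_G[a]%G R m.+1).
  - move=> i lein; rewrite subsetI sRG ?(leqW lein) //= sub_cent1.
    by rewrite (subsetP (tower_cent_le abA towR coRA minR lein (leqnSn _))).
  - by move=> i ltin; rewrite (tower_commE towR minR) // ltnW.
  by apply: fhC; rewrite !inE nta.
apply: (tower_fix_not_all_trivial pr_p abA towR coRA minR (m := m)) => //.
move=> b Bb; have Ab : b \in A by case/setDP: Bb.
apply: (@comm_chain_height _ 'C_G[b]%G (tower_fix R b) m.+1).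
- move=> i lei; apply: subset_trans (tower_fix_sub towR (erefl _) b lei) _.
  by rewrite setSI // sRG.
- by move=> i lti; rewrite (tower_fix_commE towR (erefl _)).
apply: fhC; rewrite !inE Ab andbT; case/setDP: Bb => _.
by apply: contraNneq => ->; apply: group1.
Qed.

Lemma small_cent_height_bound p n gT (A G : {group gT}) :
    prime p -> (0 < n)%N -> small_cent_height p n A G -> (p ^ n.+1 <= #|A|)%N ->
  fitting_height_le G n.+1 /\ ((p ^ n.+2 <= #|A|)%N -> fitting_height_le G n).
Proof.
move=> pr_p n_gt0 smallG cardA; have [_ gAG solG _ _] := smallG.
split=> [|cardA2].
  have [// | nhG] := fitting_height_le_dec G n.+1.
  have [q [P [towP sPG _]]] := exists_tower gAG solG nhG.
  by case: (small_cent_height_tower pr_p n_gt0 smallG cardA towP sPG).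
have [// | nhG] := fitting_height_le_dec G n.
have [q [P [towP sPG _]]] := exists_tower gAG solG nhG.
by case: (small_cent_height_tower_max pr_p smallG cardA2 towP sPG).
Qed.

(** * Good actions of [p]-groups on solvable groups *)

Lemma good_commGid gT (A H : {group gT}) :
  A \subset 'N(H) -> H \subset [~: H, A] * 'C_H(A) -> [~: H, A, A] = [~: H, A].
Proof.
move=> nHA sHRC; apply/eqP; rewrite eqEsubset commg_subl commg_normr /=.
rewrite gen_subG; apply/subsetP=> _ /imset2P[x a Hx Aa ->].
have /mulsgP[r c Rr /setIP[Hc cAc] ->] := subsetP sHRC x Hx.
have cca : [~ c, a] = 1 by apply/eqP/commgP; apply: (centP cAc).
rewrite commMgJ cca mulg1 memJ_norm ?mem_commg //.
have nAc : c \in 'N(A) by rewrite (subsetP (cent_sub A)).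
have nHc : c \in 'N(H) by rewrite (subsetP (normG H)).
by rewrite -cycle_subG !normsR // cycle_subG.
Qed.

(** Modulo [O], goodness on [K] gives [F, A] = [F, A, A], which in the [p]-group generated by [F]
    and [A] forces [F, A] = 1. By three subgroups [G, A] centralises [F], the whole Fitting subgroup
    of [G / O], so it lies in [F]; hence [G, A] = [G, A, A] vanishes modulo [O]. *)
Lemma pgood_of_good (p : nat) gT (A G : {group gT}) :
    p.-group A -> A \subset 'N(G) -> solvable G ->
    (forall H : {group gT}, H \subset G -> A \subset 'N(H) ->
       H \subset [~: H, A] * 'C_H(A)) ->
  pgood p A G.
Proof.
move=> pA nGA solG good; rewrite /pgood pA nGA /=.
pose O := 'O_p^'(G)%G; pose K := 'O_{p^', p}(G)%G; pose F := 'O_p(G / O)%G.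
have nOA : A \subset 'N(O) by rewrite gFnorm_trans.
have nOG : G \subset 'N(O) by apply: gFnorm.
have sKG : K \subset G := pseries_sub _ _.
have nKA : A \subset 'N(K) by rewrite gFnorm_trans.
have sRG : [~: G, A] \subset G by rewrite commg_subl.
have defF : K / O = F by apply: quotient_pseries2.
have FB : [~: F, A / O] = 1.
  apply/eqP; apply: contraT => ntR.
  have nFB : A / O \subset 'N(F) by rewrite -defF quotient_norms.
  have pFB : p.-group (F <*> (A / O)).
    by rewrite norm_joinEr // pgroupM pcore_pgroup quotient_pgroup.
  have sRF : [~: F, A / O] \subset F by rewrite commg_subl.
  have nOK := subset_trans sKG nOG.
  have defR : [~: F, A / O] = [~: K, A] / O by rewrite -defF quotientR.
  have : [~: [~: F, A / O], A / O] \proper [~: F, A / O].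
    apply: (nil_comm_properl (pgroup_nil pFB)) => //.
      exact: subset_trans sRF (joing_subl _ _).
    by rewrite subsetI joing_subr commg_normr.
  have nOR : [~: K, A] \subset 'N(O).
    by rewrite (subset_trans _ nOK) // commg_subl.
  by rewrite defR -quotientR // good_commGid ?good // properxx.
have RF : [~: G / O, A / O] \subset F.
  have defFit : 'F(G / O) = F by apply/Fitting_eq_pcore/trivg_pcore_quotient.
  rewrite -defFit; apply: subset_trans (solvable_cent_Fitting (quotient_sol _ solG)).
  rewrite defFit.
  rewrite subsetI -quotientR // quotientS //=; apply/commG1P.
  rewrite quotientR //; apply: three_subgroup.
    by rewrite [[~: A / O, _]]commGC FB comm1G.
  apply/trivgP; rewrite -FB commSg //.
  by rewrite commg_subl gFnorm.
have tR : [~: G, A] / O = 1.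
  rewrite -(good_commGid nGA (good G (subxx G) nGA)) !quotientR ?(subset_trans sRG) //.
  by apply/trivgP; rewrite -FB commSg.
apply: pgroupS (pcore_pgroup p^' G).
by rewrite -quotient_sub1 ?(subset_trans sRG) // tR.
Qed.

(** * From group actions to conjugation in the semidirect product *)

Section Transfer.

Variables (aT gT : finGroupType) (A : {group aT}) (G : {group gT}).
Variable to : groupAction A G.

Local Notation s1 := (sdpair1 to).
Local Notation s2 := (sdpair2 to).

Lemma morphim_sdpair_gacent (H : {set gT}) (S : {set aT}) :
  s1 @* 'C_(H | to)(S) = 'C_(s1 @* H)(s2 @* S).
Proof. by rewrite gacentEsd morphim_setIpre. Qed.

Lemma morphim_sdpair_act_commg (H : {set gT}) (B : {set aT}) :
    H \subset G -> B \subset A ->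
  s1 @* act_commg to H B \subset [~: s1 @* H, s2 @* B].
Proof.
move=> /subsetP sHG /subsetP sBA.
have sKG : [set x^-1 * to x b | x in H, b in B] \subset G.
  apply/subsetP=> _ /imset2P[x b Hx Bb ->].
  by rewrite groupM ?groupV ?gact_stable ?sHG ?sBA.
rewrite morphim_gen // genS //; apply/subsetP=> _ /morphimP[_ _ /imset2P[x b Hx Bb ->] ->].
have [Gx Ab] := (sHG x Hx, sBA b Bb).
rewrite morphM ?groupV ?gact_stable // morphV //. rewrite /= sdpair_act //.
by apply/imset2P; exists (s1 x) (s2 b); rewrite ?mem_morphim.
Qed.

Lemma good_action_sdpair (K : {group sdprod_by to}) :
    good_action to -> K \subset s1 @* G -> s2 @* A \subset 'N(K) ->
  K \subset [~: K, s2 @* A] * 'C_K(s2 @* A).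
Proof.
move=> good sKG nKA; pose H := (s1 @*^-1 K)%G.
have sHG : H \subset G := subsetIl _ _.
have defK : s1 @* H = K := morphpreK sKG.
have actH : [acts A, on H | to] by rewrite actsEsd //= defK.
have sRG : act_commg to H A \subset G.
  rewrite gen_subG; apply/subsetP=> _ /imset2P[x b Hx Ab ->].
  by rewrite groupM ?groupV ?gact_stable ?(subsetP sHG).
rewrite -{1}defK [in X in X \subset _](good A H) // morphimMl //.
by rewrite mulgSS ?morphim_sdpair_gacent ?defK // -defK morphim_sdpair_act_commg.
Qed.

Lemma small_cent_height_sdpair p n :
    p.-abelem A -> solvable G -> good_action to ->
    (forall a, a \in A^# -> fitting_height_le 'C_(G | to)[a] n) ->
  small_cent_height p n (s2 @* A) (s1 @* G).
Proof.
move=> abA solG good fhC; have nGA : s2 @* A \subset 'N(s1 @* G) := im_sdpair_norm to.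
split.
- exact: morphim_abelem.
- apply: pgood_of_good; rewrite ?morphim_sol //.
    by rewrite morphim_pgroup ?(abelem_pgroup abA).
  by move=> K sKG nKA; apply: good_action_sdpair.
- exact: morphim_sol.
- by rewrite setIC im_sdpair_TI.
move=> x /setD1P[ntx /morphimP[a _ Aa defx]]; rewrite defx in ntx *.
have ntA : a \in A^#.
  by rewrite !inE Aa andbT; apply: contraNneq ntx => ->; rewrite morph1.
rewrite -cent_set1 -(morphim_set1 (sdpair2_morphism to) Aa) -morphim_sdpair_gacent.
exact: (fitting_height_le_morphim (G := 'C_(G | to)[a]%G) _ (subsetIl _ _) (fhC a ntA)).
Qed.

Lemma fitting_height_le_sdpair n :
  fitting_height_le (s1 @* G) n -> fitting_height_le G n.
Proof.
move/(@fitting_height_lnil _ (s1 @* G)%G) => [m Gm1]; apply/fitting_height_lnil.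
exists m; apply/trivGP.
rewrite -(injmSK (injm_sdpair1 to)) ?char_sub ?lnil_char //.
by rewrite lnil_morphim // Gm1 morphim1.
Qed.

End Transfer.

Theorem theoremA (aT gT : finGroupType) (p n : nat)
  (A : {group aT}) (G : {group gT}) (to : groupAction A G) :
  prime p -> (0 < n)%N -> p.-abelem A -> (p ^ n.+1 <= #|A|)%N ->
  solvable G -> good_action to ->
  (forall a, a \in A^# -> fitting_height_le 'C_(G | to)[a] n) ->
  fitting_height_le G n.+1 /\
  ((p ^ n.+2 <= #|A|)%N -> fitting_height_le G n).
Proof.
move=> pr_p n_gt0 abA cardA solG good fhC.
have smallG := small_cent_height_sdpair abA solG good fhC.
have eqA : #|sdpair2 to @* A| = #|A| by rewrite card_injm ?injm_sdpair2.
rewrite -{}eqA in cardA *.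
have [fhG fhG2] := small_cent_height_bound pr_p n_gt0 smallG cardA.
split=> [|/fhG2 fhGn]; first exact: fitting_height_le_sdpair fhG.
exact: fitting_height_le_sdpair fhGn.
Qed.
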